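(* Let $R$ be a Noetherian ring. Then the following conditions are equivalent. (1) The space $\mathrm{Prm}(R)$ is sober. (2) The space $\mathrm{Prm}(R)$ is spectral. (3) $R$ is (isomorphic to) a direct product of rings each of which is either a zero-dimensional ring or a one-dimensional integral domain.
   Context: All rings are commutative with identity; dimension means Krull dimension. $\mathrm{Idl}(R)$ denotes the set of all ideals of a ring $R$ (including $R$ itself), endowed with the coarse lower topology: the topology having as a subbasis of closed sets the sets $\{\mathfrak a\}^{\uparrow}:=\{\mathfrak i\in\mathrm{Idl}(R)\mid \mathfrak a\subseteq\mathfrak i\}$, for $\mathfrak a$ ranging over the ideals of $R$. $\mathrm{Prm}(R)$ is the set of primary ideals of $R$ (primary ideals are proper), with the subspace topology induced from $\mathrm{Idl}(R)$. A topological space is sober if every (nonempty) irreducible closed subset is the closure of a point. A topological space is spectral if it is homeomorphic to the prime spectrum of a commutative ring with the Zariski topology; equivalently, it is quasi-compact, T$_0$, sober, and has a basis of quasi-compact open sets closed under finite intersections. *)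

(* Defs.v *)
From HB Require Import structures.
From mathcomp Require Import all_boot all_order all_algebra.
From mathcomp Require Import boolp classical_sets functions topology.

Set Implicit Arguments.
Unset Strict Implicit.
Unset Printing Implicit Defensive.

Import GRing.Theory.
Local Open Scope classical_set_scope.
Local Open Scope ring_scope.

(* Ideals are arbitrary (not necessarily decidable) subsets, possibly equal to
   the whole ring, and the zero ring is allowed; the ideals of [ring_quotient]
   are proper boolean predicates on a nonzero ring. *)
Definition is_ideal (R : comPzRingType) (I : set R) : Prop :=
  [/\ I 0, (forall x y, I x -> I y -> I (x + y))
    & (forall a x, I x -> I (a * x))].

Definition is_prime (R : comPzRingType) (P : set R) : Prop :=
  [/\ is_ideal P, ~ P 1 & forall x y, P (x * y) -> P x \/ P y].

Definition is_primary (R : comPzRingType) (Q : set R) : Prop :=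
  [/\ is_ideal Q, ~ Q 1
    & forall x y, Q (x * y) -> Q x \/ exists n : nat, Q (y ^+ n)].

Definition noetherian (R : comPzRingType) : Prop :=
  forall I : set R, is_ideal I ->
    exists s : seq R, I = smallest (@is_ideal R) [set` s].

Record Idl (R : comPzRingType) := MkIdl {
  ideal_set :> set R;
  ideal_setP : is_ideal ideal_set }.

Lemma is_ideal_setT (R : comPzRingType) : @is_ideal R setT.
Proof. by []. Qed.

HB.instance Definition _ (R : comPzRingType) := gen_eqMixin (Idl R).
HB.instance Definition _ (R : comPzRingType) := gen_choiceMixin (Idl R).
HB.instance Definition _ (R : comPzRingType) :=
  isPointed.Build (Idl R) (MkIdl (@is_ideal_setT R)).

Definition up (R : comPzRingType) (a : Idl R) : set (Idl R) :=
  [set i : Idl R | a `<=` i].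

(* The coarse lower topology: the complements of the sets [up a] form a
   subbasis of open sets. *)
HB.instance Definition _ (R : comPzRingType) :=
  @isSubBaseTopological.Build (Idl R) (Idl R) setT (fun a => ~` up a).

(* As a type, [Prm R] carries the subspace topology that the library puts on
   [set_type]. *)
Definition Prm (R : comPzRingType) : set (Idl R) :=
  [set i : Idl R | is_primary i].
Arguments Prm R : clear implicits.

Record Spec (A : comPzRingType) := MkSpec {
  prime_set :> set A;
  prime_setP : is_prime prime_set }.

HB.instance Definition _ (A : comPzRingType) := gen_eqMixin (Spec A).
HB.instance Definition _ (A : comPzRingType) := gen_choiceMixin (Spec A).

(* [S] is any subset of [A]; replacing it by the ideal that it generates does
   not change [zeros S]. *)
Definition zeros (A : comPzRingType) (S : set A) : set (Spec A) :=
  [set P : Spec A | S `<=` P].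

Definition zariski_open (A : comPzRingType) (U : set (Spec A)) : Prop :=
  exists S : set A, U = ~` zeros S.

Lemma zariski_openT (A : comPzRingType) : zariski_open (@setT (Spec A)).
Proof.
exists setT; apply/seteqP; split=> // P _ /(_ 1 I).
by case: (prime_setP P).
Qed.

Lemma zariski_openI (A : comPzRingType) (U V : set (Spec A)) :
  zariski_open U -> zariski_open V -> zariski_open (U `&` V).
Proof.
move=> [S ->] [T ->].
exists [set z | exists x y, [/\ S x, T y & z = x * y]].
rewrite -setCU; congr (~` _); apply/seteqP; split=> P; last first.
  move=> PST; have [? _ Ppr] := prime_setP P.
  have [|/existsNP[x /not_implyP[Sx nPx]]] := pselect (zeros S P); first by left.
  right=> y Ty; have Pxy : (P : set A) (x * y) by apply: PST; exists x, y.
  by case: (Ppr _ _ Pxy).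
have [[_ _ PM] _ _] := prime_setP P.
case=> PS _ [x [y [Sx Ty ->]]]; first by rewrite mulrC; apply/PM/PS.
exact/PM/PS.
Qed.

Lemma zariski_open_bigcup (A : comPzRingType) (I : Type)
    (f : I -> set (Spec A)) :
  (forall i, zariski_open (f i)) -> zariski_open (\bigcup_i f i).
Proof.
move=> /choice[S fS]; exists (\bigcup_i S i).
rewrite -[LHS]setCK setC_bigcup; congr (~` _).
apply/seteqP; split=> P => [PS x [i _ Six] | PS i _].
  by have := PS i Logic.I; rewrite fS setCK => /(_ _ Six).
by rewrite fS setCK => x Six; apply: PS; exists i.
Qed.

HB.instance Definition _ (A : comPzRingType) :=
  isOpenTopological.Build (Spec A) (@zariski_openT A) (@zariski_openI A)
    (@zariski_open_bigcup A).

Definition irreducible_closed (X : topologicalType) (F : set X) : Prop :=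
  [/\ closed F, F !=set0
    & forall F1 F2 : set X, closed F1 -> closed F2 ->
        F `<=` F1 `|` F2 -> F `<=` F1 \/ F `<=` F2].

Definition sober (X : topologicalType) : Prop :=
  forall F : set X, irreducible_closed F -> exists x : X, F = closure [set x].

Definition homeomorphic (X Y : topologicalType) : Prop :=
  exists (f : X -> Y) (g : Y -> X),
    [/\ continuous f, continuous g, cancel f g & cancel g f].

Definition spectral (X : topologicalType) : Prop :=
  exists A : comPzRingType, homeomorphic X (Spec A).

Definition prime_chain (A : comPzRingType) (n : nat)
    (p : 'I_n.+1 -> Spec A) : Prop :=
  forall i j : 'I_n.+1, (i < j)%N -> p i `<` p j.

(* In particular the zero ring has no Krull dimension in [nat]. *)
Definition has_krull_dim (A : comPzRingType) (d : nat) : Prop :=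
  (exists p : 'I_d.+1 -> Spec A, prime_chain p) /\
  (forall (n : nat) (p : 'I_n.+1 -> Spec A), prime_chain p -> (n <= d)%N).

Definition is_integral_domain (A : comPzRingType) : Prop :=
  (1 : A) <> 0 /\ forall x y : A, x * y = 0 -> x = 0 \/ y = 0.

(* A family of ring morphisms [R -> A i] is the same as a ring morphism from
   [R] to the product of the [A i] with componentwise operations. *)
Definition iso_direct_product (R : comPzRingType) (I : Type)
    (A : I -> comPzRingType) : Prop :=
  exists phi : forall i : I, {rmorphism R -> A i},
    bijective (fun (x : R) (i : I) => phi i x).

(* Main.v *)
Require Import Defs.
From HB Require Import structures.
From mathcomp Require Import all_boot all_order all_algebra finmap.
From mathcomp Require Import zify ring.
From mathcomp.multinomials Require Import monalg.
From mathcomp Require Import boolp classical_sets functions filter topology.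

(** Sober => product: if a finite set of elements outside an ideal [a] can always
be avoided by a primary ideal above [a], then sobriety makes [a] primary.  When
[m] is maximal, Krull's intersection theorem gives this property for the
contraction of [a R_m] with [a] contained in [m], so all these contractions are
primary.  For a prime [p] strictly below [m] and [x] in [p], primariness of the
contraction of [m x] forces [x = 0] in [R_m].  Hence each [R_m] is either
zero-dimensional or a one-dimensional domain, and the indecomposable idempotents
of [R] globalise this.

Product => spectral: for such a product an ideal is primary exactly when it is
proper and its quotient has no nontrivial idempotents, a condition which is
preserved by ultraproduct limits.  So Prm(R) is closed in the constructible
topology of the powerset of [R], and what is needed is Hochster's theorem: a
space [X] with an open subbasis [D s] which separates points and is closed under
ultrafilter limits is a spectrum.  The points [x] of [X] give the monomial primes
(T_s : x not in [D s]) of Z[(T_s)].  Let K be its field of fractions.  For a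
generization [y] of [x] there is a rank two valuation of K (order along [y], then
order along [x]), and [x] has the residue field generated by the T_s with [x] in
[D s].  The required ring consists of the functions which at each [x] take a
value of that field to which one fixed element of K is congruent for all the
valuations attached to [x].

Spectral => sober holds for every spectrum. *)

Set Implicit Arguments.
Unset Strict Implicit.
Unset Printing Implicit Defensive.

Import GRing.Theory.
Local Open Scope classical_set_scope.
Local Open Scope ring_scope.

(** * Weights of monomials *)

Section Weights.
Variable S : choiceType.
Implicit Types (w : S -> nat) (m : {cmonom S}) (L : seq {cmonom S}).

Definition wt w m : nat := (\sum_(i <- finsupp m) m i * w i)%N.

Lemma wtEw w m (d : {fset S}) : (finsupp m `<=` d)%fset ->
  wt w m = (\sum_(i <- d) m i * w i)%N.
Proof.
move=> le; rewrite /wt (big_fset_incl _ le) // => i _.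
by rewrite -cmE_neq0 negbK => /eqP ->.
Qed.

Lemma wtM w m1 m2 : wt w (mmul m1 m2) = (wt w m1 + wt w m2)%N.
Proof.
rewrite {1}/wt mdomD (wtEw w (fsubsetUl _ (finsupp m2))).
rewrite (wtEw w (fsubsetUr (finsupp m1) _)) -big_split /=.
by apply: eq_bigr => i _; rewrite cmM mulnDl.
Qed.

Lemma wt1 w : wt w mone = 0%N.
Proof. by rewrite /wt mdom1 big_seq_fset0. Qed.

Lemma wtU w s : wt w (ucm s) = w s.
Proof. by rewrite /wt mdomU big_seq_fset1 cmUU mul1n. Qed.

Lemma eq_wt w w' m : {in finsupp m, w =1 w'} -> wt w m = wt w' m.
Proof. by move=> e; apply: eq_big_seq => i /e ->. Qed.

Lemma leq_wt w w' m : {in finsupp m, forall s, w s <= w' s}%N ->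
  (wt w m <= wt w' m)%N.
Proof.
move=> e; rewrite /wt big_seq [leqRHS]big_seq; apply: leq_sum => i /e h.
by rewrite leq_mul2l h orbT.
Qed.

Lemma wt_comb N w w' m :
  wt (fun s => N * w s + w' s)%N m = (N * wt w m + wt w' m)%N.
Proof.
rewrite /wt big_distrr -big_split /=; apply: eq_bigr => i _.
by rewrite mulnDr mulnCA.
Qed.

Lemma wt_delta s m : wt (fun t => t == s) m = m s.
Proof.
rewrite /wt; have [sm|sm] := boolP (s \in finsupp m).
  rewrite (bigD1_seq s) ?fset_uniq//= eqxx muln1 big1 ?addn0// => i /negPf ->.
  exact: muln0.
rewrite (fsfun_dflt sm) big_seq big1// => i im.
by case: eqP => [e|]; [rewrite -e im in sm | rewrite muln0].
Qed.

Definition refines (L : seq {cmonom S}) w' w := {in L &, forall m m',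
  (wt w m < wt w m')%N -> (wt w' m < wt w' m')%N}.

Lemma refines_trans L w1 w2 w3 :
  refines L w1 w2 -> refines L w2 w3 -> refines L w1 w3.
Proof. by move=> h1 h2 m m' mL mL' h; apply: h1 => //; apply: h2. Qed.

(** The weight is scaled by [C], larger than every exponent of [s] in [L], so adding the exponent of
    one variable [s] only breaks ties. *)
Lemma refine_sep1 (L : seq {cmonom S}) w m1 m2 : m1 != m2 ->
  exists2 w', refines L w' w & wt w' m1 != wt w' m2.
Proof.
move=> m12; have [e|ne] := eqVneq (wt w m1) (wt w m2); last by exists w.
have /existsNP[s] : ~ forall s, m1 s = m2 s.
  by move=> h; case/negP: m12; apply/cmP.
move=> /eqP ns.
pose C := (\max_(m <- L) m s).+1.
exists (fun t => C * w t + (t == s))%N; last first.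
  by rewrite !wt_comb !wt_delta e eqn_add2l.
move=> m m' mL mL' h; rewrite !wt_comb !wt_delta.
have : (m s < C)%N by rewrite ltnS /C (leq_bigmax_seq (F := fun m : {cmonom S} => m s)).
by nia.
Qed.

(* An injective refinement of the weight singles out one monomial of least weight
   in each factor, and the product of these two cannot cancel. *)
Lemma refine_sep (L : seq {cmonom S}) w :
  exists2 w', refines L w' w & {in L &, injective (wt w')}.
Proof.
suff [w' h sep] : exists2 w', refines L w' w &
    {in [seq (m, m') | m <- L, m' <- L],
      forall p, p.1 != p.2 -> wt w' p.1 != wt w' p.2}.
  exists w' => // m m' mL mL' e; apply/eqP/negPn/negP => /= ne.
  have := sep (m, m') _ ne; rewrite /= e eqxx => /(_ _)/negP[] //.
  exact/allpairsP/(ex_intro _ (m, m')).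
have PL : {subset [seq (m, m') | m <- L, m' <- L] <=
    [pred p | (p.1 \in L) && (p.2 \in L)]}.
  by move=> _ /allpairsP[[m m'] [mL mL' ->]] /=; rewrite inE /= mL mL'.
elim: [seq _ | _ <- _, _ <- _] PL => [_|[m1 m2] P IH /= PL].
  by exists w.
have [|w' ref sep] := IH; first by move=> p pP; apply: PL; rewrite inE pP orbT.
have [e|ne] := eqVneq m1 m2.
  exists w' => // p; rewrite inE => /predU1P[-> /=|/sep//].
  by rewrite e eqxx.
have [w2 ref2 sep2] := refine_sep1 L w' ne.
exists w2; first exact: refines_trans ref2 ref.
move=> p; rewrite inE => /predU1P[-> //|pP] /(sep _ pP).
have /andP[p1L p2L] : (p.1 \in L) && (p.2 \in L) by apply: PL; rewrite inE pP orbT.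
by rewrite !neq_ltn => /orP[/(ref2 _ _ p1L p2L) ->|/(ref2 _ _ p2L p1L) ->]//;
  rewrite orbT.
Qed.

(** For [L] the support of a polynomial, a lower bound on its order for the monomial valuation of
    [w]. Empty support, the zero polynomial, has infinite order. *)
Definition val_ge w n L := all (fun m => n <= wt w m)%N L.

Lemma val_gePn w n L : reflect (exists2 m, m \in L & (wt w m <= n)%N)
  (~~ val_ge w n.+1 L).
Proof.
rewrite -has_predC; apply: (iffP hasP) => -[m mf h]; exists m => //=.
  by rewrite /= -ltnNge ltnS in h.
by rewrite -ltnNge ltnS.
Qed.

Lemma val_geW w n k L : (k <= n)%N -> val_ge w n L -> val_ge w k L.
Proof. by move=> kn /allP h; apply/allP => m /h; apply: leq_trans. Qed.

Lemma wt_argmin w L m0 : m0 \in L ->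
  exists2 m, m \in L & {in L, forall m', wt w m <= wt w m'}%N.
Proof.
move=> m0L; pose P n := `[< exists2 m, m \in L & wt w m = n >].
have exP : exists n, P n by exists (wt w m0); apply/asboolP; exists m0.
case: (ex_minnP exP) => n /asboolP[m mL <-] h; exists m => // m' m'L.
by apply: h; apply/asboolP; exists m'.
Qed.

(** Failure of [val_ge] at [n.+1] means order at most [n], so this is the hard half of the
    additivity of orders: upper bounds add. *)
Lemma msuppM_ngt w n k (f g : {malg int[{cmonom S}]}) :
  ~~ val_ge w n.+1 (msupp f) -> ~~ val_ge w k.+1 (msupp g) ->
  ~~ val_ge w (n + k).+1 (msupp (f * g)).
Proof.
move=> /val_gePn[mf0 mf0f hf0] /val_gePn[mg0 mg0g hg0].
have [w' ref inj] := refine_sep (msupp f ++ msupp g) w.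
have [mf mff hf] := wt_argmin w' mf0f.
have [mg mgg hg] := wt_argmin w' mg0g.
have inl m : m \in msupp f -> m \in msupp f ++ msupp g.
  by rewrite mem_cat => ->.
have inr m : m \in msupp g -> m \in msupp f ++ msupp g.
  by rewrite mem_cat orbC => ->.
(* A monomial of least [w']-weight also has least [w]-weight, because [w'] keeps every strict
   inequality of [w]. *)
have wf : (wt w mf <= n)%N.
  apply: leq_trans hf0; rewrite leqNgt; apply/negP => /ref.
  by move=> /(_ (inl _ mf0f) (inl _ mff)); rewrite ltnNge hf.
have wg : (wt w mg <= k)%N.
  apply: leq_trans hg0; rewrite leqNgt; apply/negP => /ref.
  by move=> /(_ (inr _ mg0g) (inr _ mgg)); rewrite ltnNge hg.
apply/val_gePn; exists (mmul mf mg); last by rewrite wtM leq_add.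
rewrite -mcoeff_neq0 mcoeffMl (bigD1_seq mf) ?fset_uniq//=.
rewrite (bigD1_seq mg) ?fset_uniq//= eqxx mulr1n.
have eq m1 m2 : m1 \in msupp f -> m2 \in msupp g ->
    mmul m1 m2 = mmul mf mg -> m1 = mf /\ m2 = mg.
  move=> m1f m2g /(congr1 (wt w')); rewrite !wtM => e.
  have := hf _ m1f; have := hg _ m2g => h1 h2.
  have e1 : wt w' m1 = wt w' mf by lia.
  have e2 : wt w' m2 = wt w' mg by lia.
  by split; apply: inj => //; [exact: inl|exact: inl|exact: inr|exact: inr].
rewrite big_seq_cond big1 ?addr0; last first.
  move=> m2 /andP[m2g /negP ne]; case: eqP => // /(eq _ _ mff m2g)[_ e].
  by case: ne; apply/eqP.
rewrite big_seq_cond big1 ?addr0; last first.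
  move=> m1 /andP[m1f /negP ne]; rewrite big_seq big1// => m2 m2g.
  by case: eqP => // /(eq _ _ m1f m2g)[/eqP].
by rewrite mulf_neq0 // mcoeff_neq0.
Qed.

(** For the zero weight a nonzero polynomial has order 0, and a product of two such has order at
    most 0, hence is nonzero. *)
Lemma malg_mulf_eq0 (f g : {malg int[{cmonom S}]}) :
  f * g = 0 -> (f == 0) || (g == 0).
Proof.
move=> fg; apply/norP => -[]; rewrite -!msupp_eq0.
move=> /fset0Pn[m mf] /fset0Pn[m' m'g].
have wt0 m1 : wt (fun=> 0%N) m1 = 0%N.
  by rewrite /wt big1// => i _; rewrite muln0.
have := @msuppM_ngt (fun=> 0%N) 0 0 f g; rewrite fg msupp0.
have /val_gePn -> : exists2 m, m \in msupp f & (wt (fun=> 0%N) m <= 0)%N.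
  by exists m; rewrite ?wt0.
have /val_gePn -> : exists2 m, m \in msupp g & (wt (fun=> 0%N) m <= 0)%N.
  by exists m'; rewrite ?wt0.
by move=> /(_ isT isT).
Qed.

End Weights.

(** * Valuations on the field of fractions *)

Notation polys S := {malg int[{cmonom S}]}.

Section PolysUnit.
Variable S : choiceType.
Implicit Types f g : polys S.

(** Units and inverses are chosen classically, to complete the integral domain structure from which
    the field of fractions is formed. *)
Definition polys_unit f := `[< exists g, g * f = 1 >].
Definition polys_inv f :=
  if pselect (exists g, g * f = 1) is left ex then projT1 (cid ex) else f.

Lemma polys_mulVr : {in polys_unit, left_inverse 1 polys_inv *%R}.
Proof.
move=> f /asboolP ex; rewrite /polys_inv.
by case: pselect => // ex'; case: (cid ex').
Qed.

Lemma polys_unitP f g : g * f = 1 -> polys_unit f.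
Proof. by move=> e; apply/asboolP; exists g. Qed.

Lemma polys_inv_out : {in [predC polys_unit], polys_inv =1 id}.
Proof. by move=> f /asboolPn nex; rewrite /polys_inv; case: pselect. Qed.

HB.instance Definition _ := GRing.ComNzRing_hasMulInverse.Build (polys S)
  polys_mulVr polys_unitP polys_inv_out.

HB.instance Definition _ := GRing.ComUnitRing_isIntegral.Build (polys S)
  (@malg_mulf_eq0 S).
End PolysUnit.

(* An abstract interface to [polys S]: with the concrete ring structure in sight,
   rewriting with ring morphism lemmas does not terminate in practice. *)
Record monom_domain (S : choiceType) := MonomDomain {
  md_ring :> idomainType;
  supp : md_ring -> {fset {cmonom S}};
  var : S -> md_ring;
  supp_eq0 : forall f, (supp f == fset0)%fset = (f == 0);
  supp1 : supp 1 = [fset mone]%fset;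
  suppN : forall f, supp (- f) = supp f;
  suppD_le : forall f g, (supp (f + g) `<=` supp f `|` supp g)%fset;
  suppD : forall f g, [disjoint supp f & supp g]%fset ->
    supp (f + g) = (supp f `|` supp g)%fset;
  suppM_le : forall f g m, m \in supp (f * g) -> exists m1 m2,
    [/\ m1 \in supp f, m2 \in supp g & m = mmul m1 m2];
  suppM_ngt : forall w n k f g, ~~ val_ge w n.+1 (supp f) ->
    ~~ val_ge w k.+1 (supp g) -> ~~ val_ge w (n + k).+1 (supp (f * g));
  supp_var : forall s, supp (var s) = [fset ucm s]%fset }.

Lemma monom_domain_exists (S : choiceType) : inhabited (monom_domain S).
Proof.
constructor.
refine (@MonomDomain S (polys S : idomainType) (fun f => msupp f)
  (fun s => mkmalgU (ucm s) 1) _ _ _ _ _ _ _ _).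
- exact: msupp_eq0.
- exact: msuppU1.
- exact: msuppN.
- exact: msuppD_le.
- exact: msuppD.
- exact: msuppM_le.
- exact: msuppM_ngt.
- move=> s; exact: msuppU1.
Qed.

Lemma fraction_repr (R : idomainType) (x : {fraction R}) :
  exists n d : R, d != 0 /\ x = FracField.tofrac n / FracField.tofrac d.
Proof.
elim/quotW: x => r; exists \n_r, \d_r; split; first exact: denom_ratioP.
unlock FracField.tofrac.
rewrite -[X in _ = _ * X]FracField.pi_inv -[RHS]FracField.pi_mul.
rewrite /FracField.mulf /FracField.invf /= !numden_Ratio ?oner_neq0 ?denom_ratioP//.
by rewrite mulr1 mul1r Ratio_numden.
Qed.

Section Valuations.
Variables (S : choiceType) (B : monom_domain S) (K : fieldType).
Variable tf : {rmorphism B -> K}.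
Hypothesis tf_inj : injective tf.
Hypothesis tf_frac : forall h : K, exists g f : B, f != 0 /\ h = tf g / tf f.
Implicit Types (u v w : S -> nat) (f g : B) (h c : K).

Lemma tf_eq0 f : (tf f == 0) = (f == 0).
Proof. by rewrite -(inj_eq tf_inj) rmorph0. Qed.

Lemma supp0 : supp (0 : B) = fset0.
Proof. by apply/eqP; rewrite supp_eq0. Qed.

Local Notation vge w n f := (val_ge w n (supp f)).

Lemma val_ge0 w f : vge w 0 f.
Proof. exact/allP. Qed.

Lemma val_ge_zero w n : vge w n (0 : B).
Proof. by apply/allP => m; rewrite supp0 inE. Qed.

Lemma val_ge_one w n : ~~ vge w n.+1 (1 : B).
Proof. by apply/val_gePn; exists mone; rewrite ?supp1 ?inE// wt1. Qed.

Lemma wt_supp1 w m : m \in supp (1 : B) -> wt w m = 0%N.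
Proof. by rewrite supp1 => /fset1P ->; rewrite wt1. Qed.

Lemma val_geD w n f g : vge w n f -> vge w n g -> vge w n (f + g).
Proof.
move=> /allP hf /allP hg; apply/allP => m /(fsubsetP (suppD_le f g)).
by rewrite in_fsetE => /orP[/hf|/hg].
Qed.

Lemma val_geM w n k f g : vge w n f -> vge w k g -> vge w (n + k) (f * g).
Proof.
move=> /allP hf /allP hg; apply/allP => m /suppM_le[m1 [m2 [/hf h1 /hg h2 ->]]].
by rewrite wtM leq_add.
Qed.

Lemma supp_argmin w f : f != 0 ->
  exists2 m, m \in supp f & {in supp f, forall m', wt w m <= wt w m'}%N.
Proof. by rewrite -supp_eq0 => /fset0Pn[m /(wt_argmin w)]. Qed.

Lemma val_ge_neq0 w n f : ~~ vge w n f -> f != 0.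
Proof. by apply: contraNneq => ->; apply: val_ge_zero. Qed.

Lemma val_exact w f : f != 0 -> exists n, vge w n f /\ ~~ vge w n.+1 f.
Proof.
move=> /(supp_argmin w)[m mf h]; exists (wt w m); split; first exact/allP.
by apply/val_gePn; exists m.
Qed.

(* [v_w (h) >= d] for the monomial valuation [v_w], without naming its value:
   [n] separates the values of the two members of a fraction. *)
Definition ord_ge w d h := exists g f n,
  [/\ h = tf g / tf f, vge w (n + d) g & ~~ vge w n.+1 f].

(** Independence of the chosen fraction: after cross-multiplication, too small an order of [g] would
    contradict the additivity of orders. *)
Lemma ord_geE w d g f : f != 0 -> ord_ge w d (tf g / tf f) <->
  exists n, vge w (n + d) g /\ ~~ vge w n.+1 f.
Proof.
move=> f0; split=> [[g' [f' [n [e hg hf]]]]|[n [hg hf]]]; last by exists g, f, n.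
have [k [fk fk1]] := val_exact w f0; exists k; split => //.
have {}e : g * f' = g' * f.
  apply: tf_inj; rewrite (rmorphM tf).
  rewrite (rmorphM tf).
  apply/eqP; rewrite -eqr_div ?tf_eq0 ?f0 ?(val_ge_neq0 hf)//.
  exact/eqP.
case kd: (k + d)%N => [|j]; first exact: val_ge0.
apply/negPn/negP => ng; have := suppM_ngt ng hf; rewrite e.
have -> : (j + n).+1 = (n + d + k)%N by lia.
by rewrite val_geM.
Qed.

Lemma ord_geW w d d' h : (d' <= d)%N -> ord_ge w d h -> ord_ge w d' h.
Proof.
move=> dd [g [f [n [-> hg hf]]]]; exists g, f, n; split => //.
by apply: val_geW hg; rewrite leq_add2l.
Qed.

Lemma ord_ge0 w d : ord_ge w d 0.
Proof.
exists 0, 1, 0%N; rewrite rmorph0 mul0r; split => //; first exact: val_ge_zero.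
exact: val_ge_one.
Qed.

Lemma ord_geN w d h : ord_ge w d h -> ord_ge w d (- h).
Proof.
move=> [g [f [n [-> hg hf]]]]; exists (- g), f, n.
by rewrite rmorphN mulNr suppN.
Qed.

Lemma ord_geM w d d' h h' :
  ord_ge w d h -> ord_ge w d' h' -> ord_ge w (d + d') (h * h').
Proof.
move=> [g [f [n [-> hg hf]]]] [g' [f' [n' [-> hg' hf']]]].
exists (g * g'), (f * f'), (n + n')%N; split.
- by rewrite !rmorphM mulf_div.
- by rewrite addnACA val_geM.
- exact: suppM_ngt.
Qed.

Lemma ord_geD w d h h' : ord_ge w d h -> ord_ge w d h' -> ord_ge w d (h + h').
Proof.
move=> [g [f [n [-> hg hf]]]] [g' [f' [n' [-> hg' hf']]]].
have [k [fk fk1]] := val_exact w (val_ge_neq0 hf).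
have [k' [fk' fk1']] := val_exact w (val_ge_neq0 hf').
exists (g * f' + g' * f), (f * f'), (k + k')%N; split.
- by rewrite rmorphD !rmorphM addf_div // tf_eq0; apply: val_ge_neq0; eassumption.
- have kn : (k <= n)%N.
    by rewrite leqNgt; apply/negP => nk; case/negP: hf; apply: val_geW fk.
  have kn' : (k' <= n')%N.
    by rewrite leqNgt; apply/negP => nk; case/negP: hf'; apply: val_geW fk'.
  apply: val_geD.
    by apply: val_geW (val_geM hg fk'); lia.
  by apply: val_geW (val_geM hg' fk); lia.
- exact: suppM_ngt.
Qed.

Lemma ord_geX w d h n : ord_ge w d h -> ord_ge w (n * d) (h ^+ n).
Proof.
move=> hd; elim: n => [|n IH]; last by rewrite exprS mulSn; apply: ord_geM.
exists 1, 1, 0%N; rewrite expr0 divff ?tf_eq0 ?oner_eq0//; split => //.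
  exact: val_ge0.
exact: val_ge_one.
Qed.

Lemma ord_geV w h : ~ ord_ge w 1 h -> ord_ge w 0 h^-1.
Proof.
have [g [f [f0 ->]]] := tf_frac h.
have [-> |g0] := eqVneq g 0.
  by rewrite rmorph0 mul0r => /(_ (ord_ge0 _ _)).
have [k [fk fk1]] := val_exact w f0.
have [n [gn gn1]] := val_exact w g0.
move=> h1; exists f, g, n; rewrite invf_div; split => //.
rewrite addn0; apply: val_geW fk; rewrite leqNgt; apply/negP => kn.
apply: h1; apply/ord_geE => //; exists k; split => //.
by apply: val_geW gn; rewrite addn1.
Qed.

(** The conditions on [f] and [g] say that the divisor has order at most [b]. *)
Lemma ord_ge_div w a b n g f p : f != 0 -> vge w n f -> ~~ vge w (n + b).+1 g ->
  ord_ge w (a + b) p -> ord_ge w a (p / (tf g / tf f)).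
Proof.
move=> f0 fn gn [g1 [f1 [k [-> hg hf]]]].
exists (g1 * f), (f1 * g), (k + (n + b))%N; split.
- by rewrite invf_div mulf_div !rmorphM.
- by apply: val_geW (val_geM hg fn); lia.
- exact: suppM_ngt.
Qed.

(* Positivity for the rank two valuation "order along [v], then order along [u]",
   encoded by the rank one weights [N * v + u] with [N] large. *)
Definition ev_pos u v h := exists N0, forall N, (N0 <= N)%N ->
  ord_ge (fun s => N * v s + u s)%N 1 h.

Lemma ev_pos0 u v : ev_pos u v 0.
Proof. by exists 0%N => N _; apply: ord_ge0. Qed.

Lemma ev_posN u v h : ev_pos u v h -> ev_pos u v (- h).
Proof. by move=> [N0 H]; exists N0 => N /H; apply: ord_geN. Qed.

Lemma ev_posD u v h h' : ev_pos u v h -> ev_pos u v h' -> ev_pos u v (h + h').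
Proof.
move=> [N0 H] [N1 H1]; exists (maxn N0 N1) => N; rewrite geq_max => /andP[/H ? /H1].
exact: ord_geD.
Qed.

Definition ev_int u v h := exists N0, forall N, (N0 <= N)%N ->
  ord_ge (fun s => N * v s + u s)%N 0 h.

Lemma ev_pos_int u v h : ev_pos u v h -> ev_int u v h.
Proof. by move=> [N0 H]; exists N0 => N /H; apply: ord_geW. Qed.

Lemma ev_intD u v h h' : ev_int u v h -> ev_int u v h' -> ev_int u v (h + h').
Proof.
move=> [N0 H] [N1 H1]; exists (maxn N0 N1) => N; rewrite geq_max => /andP[/H ? /H1].
exact: ord_geD.
Qed.

Lemma ev_posM u v h h' : ev_int u v h -> ev_pos u v h' -> ev_pos u v (h * h').
Proof.
move=> [N0 H] [N1 H1]; exists (maxn N0 N1) => N; rewrite geq_max => /andP[/H h0 /H1].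
by move/(ord_geM h0).
Qed.

(** The rational functions in the variables of weight 0: a copy inside [K] of the residue field at
    the monomial prime of [u]. *)
Definition res_field u c := exists g f, [/\ f != 0, c = tf g / tf f,
  {in supp g, forall m, wt u m = 0%N} & {in supp f, forall m, wt u m = 0%N}].

Lemma zero_wtD u f g : {in supp f, forall m, wt u m = 0%N} ->
  {in supp g, forall m, wt u m = 0%N} -> {in supp (f + g), forall m, wt u m = 0%N}.
Proof.
by move=> hf hg m /(fsubsetP (suppD_le f g)); rewrite in_fsetE => /orP[/hf|/hg].
Qed.

Lemma zero_wtM u f g : {in supp f, forall m, wt u m = 0%N} ->
  {in supp g, forall m, wt u m = 0%N} -> {in supp (f * g), forall m, wt u m = 0%N}.
Proof. by move=> hf hg m /suppM_le[m1 [m2 [/hf h1 /hg h2 ->]]]; rewrite wtM h1 h2. Qed.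

Lemma res_field_poly u g : {in supp g, forall m, wt u m = 0%N} -> res_field u (tf g).
Proof.
move=> hg; exists g, 1; rewrite oner_eq0 rmorph1 divr1; split => // m.
exact: wt_supp1.
Qed.

Lemma res_field0 u : res_field u 0.
Proof. by rewrite -(rmorph0 tf); apply: res_field_poly => m; rewrite supp0. Qed.

Lemma res_field1 u : res_field u 1.
Proof.
rewrite -(rmorph1 tf); apply: res_field_poly => m.
exact: wt_supp1.
Qed.

Lemma res_fieldB u c c' : res_field u c -> res_field u c' -> res_field u (c - c').
Proof.
move=> [g [f [f0 -> hg hf]]] [g' [f' [f0' -> hg' hf']]].
exists (g * f' + (- g') * f), (f * f'); split; rewrite ?mulf_neq0//.
- by rewrite -mulNr -rmorphN rmorphD !rmorphM addf_div // tf_eq0.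
- by apply: zero_wtD; apply: zero_wtM => //; move=> m; rewrite suppN; apply: hg'.
- exact: zero_wtM.
Qed.

Lemma res_fieldM u c c' : res_field u c -> res_field u c' -> res_field u (c * c').
Proof.
move=> [g [f [f0 -> hg hf]]] [g' [f' [f0' -> hg' hf']]].
exists (g * g'), (f * f'); split; rewrite ?mulf_neq0//.
- by rewrite !rmorphM mulf_div.
- exact: zero_wtM.
- exact: zero_wtM.
Qed.

Lemma res_fieldV u c : res_field u c -> res_field u c^-1.
Proof.
move=> [g [f [f0 -> hg hf]]]; have [->|g0] := eqVneq g 0.
  by rewrite rmorph0 mul0r invr0; apply: res_field0.
by exists f, g; rewrite invf_div.
Qed.

(** Every monomial of the numerator [g] has [w]-weight 0, so a nonzero [g] has order 0. *)
Lemma res_field_pos w u c : (forall s, u s = 0%N -> w s = 0%N) ->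
  res_field u c -> ord_ge w 1 c -> c = 0.
Proof.
move=> uw [g [f [f0 -> hg hf]]] /(ord_geE _ _ _ f0)[n [/allP gn _]].
suff -> : g = 0 by rewrite rmorph0 mul0r.
apply/eqP/negPn; rewrite -supp_eq0; apply/negP => /fset0Pn[m mg].
have := gn _ mg; suff -> : wt w m = 0%N by rewrite addn1.
have /eqP := hg _ mg; rewrite /wt sum_nat_seq_eq0 => /allP h.
apply/eqP; rewrite sum_nat_seq_eq0; apply/allP => s /h /=.
by rewrite !muln_eq0 => /orP[->//|/eqP/uw ->]; rewrite orbT.
Qed.

Lemma res_field_int w u c : (forall s, u s = 0%N -> w s = 0%N) ->
  res_field u c -> ord_ge w 0 c.
Proof.
move=> uw [g [f [f0 -> hg hf]]]; apply/ord_geE => //; exists 0%N; split.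
  exact: val_ge0.
have /fset0Pn[m mf] : supp f != fset0 by rewrite supp_eq0.
apply/val_gePn; exists m => //.
have /eqP := hf _ mf; rewrite /wt sum_nat_seq_eq0 => /allP h.
rewrite leqn0 sum_nat_seq_eq0; apply/allP => s /h /=.
by rewrite !muln_eq0 => /orP[->//|/eqP/uw ->]; rewrite orbT.
Qed.

Lemma comb_support N u v : (forall s, v s <= u s)%N ->
  forall s, u s = 0%N -> (N * v s + u s = 0)%N.
Proof. by move=> h s us; have := h s; rewrite us; lia. Qed.

Lemma res_field_ev_pos u v c : (forall s, v s <= u s)%N ->
  res_field u c -> ev_pos u v c -> c = 0.
Proof.
move=> uv rc [N /(_ _ (leqnn N))]; apply: (res_field_pos (u := u)) rc.
exact: comb_support.
Qed.

Lemma res_field_ev_int u v c : (forall s, v s <= u s)%N ->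
  res_field u c -> ev_int u v c.
Proof.
move=> uv rc; exists 0%N => N _; apply: res_field_int rc; exact: comb_support.
Qed.

Definition lt_wt v f g :=
  exists2 m0, m0 \in supp f & {in supp g, forall m, wt v m0 < wt v m}%N.

Lemma lt_wt_ev_pos u v f g : f != 0 -> lt_wt v f g -> ev_pos u v (tf g / tf f).
Proof.
(* For such [N], one unit of [v]-weight outweighs the whole [u]-weight of [m0]. *)
move=> f0 [m0 m0f hg]; exists (wt u m0).+1 => N hN; apply/ord_geE => //.
exists (N * wt v m0 + wt u m0)%N; split.
  by apply/allP => m /hg h; rewrite wt_comb; nia.
by apply/val_gePn; exists m0 => //; rewrite wt_comb.
Qed.

(** With both weights equal to [v], the combined weight is a multiple of [v], and positivity becomes
    a rank one condition independent of [N]. *)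
Lemma ev_posP v f g : f != 0 -> ev_pos v v (tf g / tf f) <-> lt_wt v f g.
Proof.
move=> f0; split; last exact: lt_wt_ev_pos.
move=> [N /(_ _ (leqnn N))] /(ord_geE _ _ _ f0)[n [/allP hg /val_gePn[m0 m0f h]]].
exists m0 => // m /hg; move: h; rewrite !wt_comb; nia.
Qed.

(** The order along [v] is compared first, so once it is positive the weight [u] is irrelevant. This
    is what makes vanishing pass to specializations. *)
Lemma ev_pos_center u v h : ev_pos v v h -> ev_pos u v h.
Proof.
by have [g [f [f0 ->]]] := tf_frac h => /(ev_posP _ _ f0); apply: lt_wt_ev_pos.
Qed.

(* The exponent works for all [u] and [v] at once because the order of [h] along
   0-1 weights is controlled by the degree of its numerator. *)
Lemma ev_pos_divX h : h != 0 -> exists2 n, (0 < n)%N & forall u v h',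
  (forall s, u s <= 1)%N -> (forall s, v s <= 1)%N ->
  ev_pos u v h' -> ev_pos v v h' \/ ~ ev_pos v v h -> ev_pos u v (h' ^+ n / h).
Proof.
have [g [f [f0 ->]]] := tf_frac h => gf0.
have g0 : g != 0 by apply: contraNneq gf0 => ->; rewrite rmorph0 mul0r.
pose D := \max_(m <- supp g) wt (fun=> 1%N) m.
have leD w m : (forall s, w s <= 1)%N -> m \in supp g -> (wt w m <= D)%N.
  move=> w1 mg; apply: (@leq_trans (wt (fun=> 1%N) m)); first exact: leq_wt.
  exact: (leq_bigmax_seq (F := wt (fun=> 1%N))).
exists D.+1 => // u v h' u1 v1 ev' [evv|nev].
- have [g' [f' [f'0 e]]] := tf_frac h'; move: evv; rewrite e.
  move=> /(ev_posP _ _ f'0)[m0 m0f' hg'].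
  (* The power of [h'] has order at least [D.+1 * (N - ee)] and [h] has order at most [N * D + D];
     the former is larger from this bound on. *)
  set ee := wt u m0; exists (D.+1 * ee.+1)%N => N hN.
  have /fset0Pn[m1 m1g] : supp g != fset0 by rewrite supp_eq0.
  apply: (@ord_ge_div _ _ (N * D + D) 0) => //; first exact: val_ge0.
    apply/val_gePn; exists m1 => //; rewrite add0n wt_comb.
    by rewrite leq_add ?leq_mul// leD.
  apply: (@ord_geW _ (D.+1 * (N - ee))); first by nia.
  apply: ord_geX; apply/ord_geE => //; exists (N * wt v m0 + ee)%N; split.
    by apply/allP => m /hg' h1; rewrite wt_comb; nia.
  by apply/val_gePn; exists m0 => //; rewrite wt_comb.
(* Here [h] has order at most 0 along [v], hence at most [D] for the combined weight whatever [N]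
   is, while [h' ^+ D.+1] has order at least [D.+1]. *)
- have [N0 H] := ev'; exists N0 => N /H {}H.
  have [m0 m0f m0min] := supp_argmin (fun s => N * v s + u s)%N f0.
  apply: (@ord_ge_div _ _ D (wt (fun s => N * v s + u s)%N m0)) => //.
  + exact/allP.
  + have : ~ lt_wt v f g by move=> /(lt_wt_ev_pos v f0).
    move=> nlt; apply/val_gePn; apply: contrapT => nex; apply: nlt.
    exists m0 => // m mg; rewrite ltnNge; apply/negP => le; apply: nex.
    exists m => //; rewrite !wt_comb; have := leD u m u1 mg; nia.
  + by apply: ord_geW (ord_geX D.+1 H); rewrite muln1 add1n.
Qed.

End Valuations.

(** * A ring with prescribed spectrum *)

Section Spring.
Variables (X : topologicalType) (S : choiceType) (D : S -> set X).
Variables (B : monom_domain S) (K : fieldType) (tf : {rmorphism B -> K}).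
Hypothesis tf_inj : injective tf.
Hypothesis tf_frac : forall h : K, exists g f : B, f != 0 /\ h = tf g / tf f.

(* The monomial prime of [x] is generated by the variables of weight 1. *)
Definition off (x : X) (s : S) : nat := `[< ~ D s x >].

Definition generizes (y x : X) := forall s, (off y s <= off x s)%N.

Lemma off_le1 x s : (off x s <= 1)%N. Proof. exact: leq_b1. Qed.

Lemma generizes_refl x : generizes x x. Proof. by move=> s. Qed.

Lemma off0 x s : D s x -> off x s = 0%N.
Proof. by move=> Dsx; rewrite /off; case: asboolP. Qed.

Lemma off1 x s : ~ D s x -> off x s = 1%N.
Proof. by move=> Dsx; rewrite /off; case: asboolP. Qed.

Lemma generizesP y x : (forall s, D s x -> D s y) -> generizes y x.
Proof.
move=> h s; have [Dsx|nDsx] := pselect (D s x); first by rewrite (off0 (h _ Dsx)).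
by rewrite (off1 nDsx) off_le1.
Qed.

(* [h] is one element of the field inducing the function [phi]: its residue at [x]
   is [phi x], along all generizations [y] of [x]. *)
Definition has_symbol (phi : X -> K) (h : K) := forall x,
  res_field tf (off x) (phi x) /\
  forall y, generizes y x -> ev_pos tf (off x) (off y) (h - phi x).

Definition spring_pred : {pred X -> K} := fun phi => `[< exists h, has_symbol phi h >].

Lemma has_symbol0 : has_symbol 0 0.
Proof.
by move=> x; split=> [|y yx]; [exact: res_field0 | rewrite subrr; exact: ev_pos0].
Qed.

Lemma has_symbol1 : has_symbol 1 1.
Proof.
by move=> x; split=> [|y yx]; [exact: res_field1 | rewrite subrr; exact: ev_pos0].
Qed.

Lemma has_symbolB phi psi h k :
  has_symbol phi h -> has_symbol psi k -> has_symbol (phi - psi) (h - k).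
Proof.
move=> hp hq x; have [r1 e1] := hp x; have [r2 e2] := hq x.
split=> [|y yx]; first exact: res_fieldB.
have -> : h - k - (phi - psi) x = (h - phi x) + - (k - psi x).
  by rewrite (_ : (phi - psi) x = phi x - psi x)//; ring.
apply: ev_posD => //; first exact: e1.
by apply: ev_posN; apply: e2.
Qed.

Lemma symbol_int phi h x y : has_symbol phi h -> generizes y x ->
  ev_int tf (off x) (off y) h.
Proof.
move=> /(_ x)[r e] yx; rewrite -(subrK (phi x) h); apply: ev_intD => //.
  exact/ev_pos_int/e.
exact: res_field_ev_int yx r.
Qed.

Lemma has_symbolM phi psi h k :
  has_symbol phi h -> has_symbol psi k -> has_symbol (phi * psi) (h * k).
Proof.
move=> hp hq x; have [r1 e1] := hp x; have [r2 e2] := hq x.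
split=> [|y yx]; first exact: res_fieldM.
have -> : h * k - (phi * psi) x = h * (k - psi x) + psi x * (h - phi x).
  by rewrite (_ : (phi * psi) x = phi x * psi x)//; ring.
apply: ev_posD => //; apply: ev_posM => //.
- exact: symbol_int hp yx.
- exact: e2.
- exact: res_field_ev_int yx r2.
- exact: e1.
Qed.

Lemma spring_pred_subring : subring_closed spring_pred.
Proof.
split=> [|phi psi /asboolP[h hp] /asboolP[k hq]|phi psi /asboolP[h hp] /asboolP[k hq]].
- by apply/asboolP; exists 1; apply: has_symbol1.
- by apply/asboolP; exists (h - k); apply: has_symbolB.
- by apply/asboolP; exists (h * k); apply: has_symbolM.
Qed.

(** [h] and [phi x] differ by a positive element, and the residue field has no positive element
    except 0. So each valuation attached to [x] detects vanishing at [x]. *)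
Lemma symbol_eq0 phi h x y : has_symbol phi h -> generizes y x ->
  phi x = 0 <-> ev_pos tf (off x) (off y) h.
Proof.
move=> /(_ x)[r e] yx; split=> [p0|eh]; first by have := e _ yx; rewrite p0 subr0.
apply: (res_field_ev_pos tf_inj yx r).
rewrite -(subKr h (phi x)); apply: ev_posD => //.
exact/ev_posN/e.
Qed.

Lemma symbol_specialize phi h x y : has_symbol phi h -> generizes y x ->
  phi y = 0 -> phi x = 0.
Proof.
move=> hp yx /(symbol_eq0 hp (generizes_refl y)) e.
by apply/(symbol_eq0 hp yx); apply: ev_pos_center.
Qed.

(** Vanishing only compares the weights of the monomials of [f] and [g], in which finitely many
    variables occur. *)
Lemma symbol_constructible phi h : has_symbol phi h -> exists F : seq S,
  forall x y, (forall s, s \in F -> D s x <-> D s y) -> phi x = 0 -> phi y = 0.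
Proof.
move=> hp; have [g [f [f0 hE]]] := tf_frac h.
exists (flatten [seq enum_fset (finsupp m) | m : {cmonom S} <-
  enum_fset (supp f) ++ enum_fset (supp g)]).
move=> x y xy /(symbol_eq0 hp (generizes_refl x)); rewrite hE.
move=> /(ev_posP tf_inj _ _ f0)[m0 m0f hg].
apply/(symbol_eq0 hp (generizes_refl y)); rewrite hE; apply/ev_posP => //.
have wxy m : m \in enum_fset (supp f) ++ enum_fset (supp g) ->
    wt (off x) m = wt (off y) m.
  move=> mfg; apply: eq_wt => s sm; rewrite /off; congr (nat_of_bool _).
  have sxy : D s x <-> D s y.
    by apply: xy; apply/flatten_mapP; exists m.
  by apply: asbool_equiv_eq; tauto.
exists m0 => // m mg; rewrite -!wxy ?mem_cat ?m0f ?mg ?orbT//.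
exact: hg.
Qed.

(** This divisibility up to a power is the analogue of the Nullstellensatz: it makes membership in a
    prime of the ring depend on zero sets only. *)
Lemma symbol_divX phi psi h k : has_symbol phi h -> has_symbol psi k ->
  (forall x, phi x = 0 -> psi x = 0) ->
  exists2 n, (0 < n)%N & has_symbol (fun x => psi x ^+ n / phi x) (k ^+ n / h).
Proof.
move=> hp hq pq; have [h0|h0] := eqVneq h 0.
  have p0 x : phi x = 0.
    by apply/(symbol_eq0 hp (generizes_refl x)); rewrite h0; apply: ev_pos0.
  exists 1%N => //; rewrite h0 invr0 mulr0.
  rewrite (_ : (fun x => _) = 0); first exact: has_symbol0.
  by apply/funext => x; rewrite p0 invr0 mulr0.
have [n n0 H] := ev_pos_divX tf_inj tf_frac h0; exists n => // x.
have [rp ep] := hp x; have [rq eq] := hq x.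
have rX c m : res_field tf (off x) c -> res_field tf (off x) (c ^+ m).
  move=> rc; elim: m => [|m IH]; first exact: res_field1.
  by rewrite exprS; apply: res_fieldM.
split=> [|y yx]; first by apply: res_fieldM; [exact: rX|exact: res_fieldV].
(* As the inverse of 0 is 0, the quotient takes the value 0 here, and its symbol must be positive
   along every generization. *)
have [p0|p0] := eqVneq (phi x) 0.
  have q0 := pq _ p0; rewrite p0 invr0 mulr0 subr0.
  apply: H; [exact: off_le1|exact: off_le1|exact/(symbol_eq0 hq yx)|].
  have [q0y|q0y] := pselect (psi y = 0); first by left; apply/symbol_eq0.
  right=> /(symbol_eq0 hp (generizes_refl y)) /pq //.
have hn0 : ~ ev_pos tf (off x) (off y) h.
  by move=> /(symbol_eq0 hp yx) /eqP; apply/negP.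
(* If [h] had order at least 1, so would the nonzero residue [phi x], which is impossible. *)
have Vint : ev_int tf (off x) (off y) h^-1.
  have [N0 HN] := ep _ yx; exists N0 => N /HN oN.
  apply: ord_geV => // o1; case/eqP: p0.
  apply: (@res_field_pos _ _ _ _ tf_inj (fun s => N * off y s + off x s)%N (off x)) => //.
    exact: comb_support.
  rewrite -(subKr h (phi x)); apply: ord_geD => //; exact: ord_geN.
have eX m : ev_pos tf (off x) (off y) (k ^+ m - psi x ^+ m).
  elim: m => [|m IH]; first by rewrite subrr; apply: ev_pos0.
  have -> : k ^+ m.+1 - psi x ^+ m.+1 =
      k * (k ^+ m - psi x ^+ m) + psi x ^+ m * (k - psi x).
    by rewrite !exprS; ring.
  apply: ev_posD => //; apply: ev_posM => //; [exact: symbol_int hq yx| |exact: eq].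
  exact: res_field_ev_int yx (rX _ _ rq).
have -> : k ^+ n / h - psi x ^+ n / phi x =
   h^-1 * (k ^+ n - psi x ^+ n) + h^-1 * ((psi x ^+ n / phi x) * - (h - phi x)).
  by field; rewrite h0 p0.
have rc : res_field tf (off x) (psi x ^+ n / phi x).
  by apply: res_fieldM; [exact: rX|exact: res_fieldV].
apply: ev_posD => //; first exact: ev_posM.
apply: ev_posM => //; apply: ev_posM; first exact: res_field_ev_int rc.
exact/ev_posN/ep.
Qed.

Hypothesis D_open : forall s, open (D s).
Hypothesis D_nbhs : forall (U : set X) x, open U -> U x ->
  exists2 F : seq S, (forall s, s \in F -> D s x) &
    forall y, (forall s, s \in F -> D s y) -> U y.
Hypothesis D_sep : forall x y, (forall s, D s x <-> D s y) -> x = y.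
Hypothesis D_ultra : forall U : set_system X, UltraFilter U ->
  exists x, forall s, D s x <-> U (D s).

Lemma D_seq_nbhs x (F : seq S) : (forall s, s \in F -> D s x) ->
  nbhs x [set y | forall s, s \in F -> D s y].
Proof.
elim: F => [|t F IH] Fx; first exact: filterS filterT.
have Dt : nbhs x (D t) by apply: open_nbhs_nbhs; split=> //; apply/Fx/mem_head.
have DF := IH (fun s sF => Fx s (mem_behead (s := t :: F) sF)).
apply: filterS (filterI Dt DF) => y [Dty {}DF] s.
by rewrite inE => /predU1P[->|/DF].
Qed.

(** If [x] were not interior, some ultrafilter would contain the zeros of [phi] and all basic
    neighbourhoods of [x]. Its limit [y] is a generization of [x]; constructibility gives
    [phi y = 0], and specialization gives [phi x = 0]. *)
Lemma symbol_open phi h : has_symbol phi h -> open [set x | phi x != 0].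
Proof.
move=> hp; rewrite openE => x /= px; apply: contrapT => nn.
have meet (s : seq S) : (forall t, t \in s -> D t x) ->
    exists y, (forall t, t \in s -> D t y) /\ phi y = 0.
  move=> sx; apply: contrapT => nex; apply: nn.
  apply: filterS (D_seq_nbhs sx) => y /= sy; apply/eqP => py.
  by apply: nex; exists y.
pose Dom := [set s : seq S | forall t, t \in s -> D t x].
pose E (s : seq S) := [set y | (forall t, t \in s -> D t y) /\ phi y = 0].
have : ProperFilter (filter_from Dom E).
  apply: filter_from_proper; last by move=> s /meet[y ?]; exists y.
  apply: filter_from_filter; first by exists [::].
  move=> s1 s2 h1 h2; exists (s1 ++ s2).
    by move=> t; rewrite mem_cat => /orP[/h1|/h2].
  move=> y [hy py]; split; split=> // t ts; apply: hy; rewrite mem_cat ts ?orbT//.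
move=> /ultraFilterLemma[U [UU subU]].
have [y yU] := D_ultra UU.
have yx : generizes y x.
  apply: generizesP => s Dsx; apply/yU/subU; exists [:: s].
    by move=> t; rewrite inE => /eqP ->.
  by move=> z [+ _]; apply; rewrite mem_head.
case/eqP: px; apply: (symbol_specialize hp yx).
have [F HF] := symbol_constructible hp.
have UF : U [set z | forall s, s \in F -> D s z <-> D s y].
  elim: F {HF} => [|t F IH]; first exact: filterS filterT.
  suff Ut : U [set z | D t z <-> D t y].
    apply: filterS (filterI Ut IH) => z [zt zF] s.
    by rewrite inE => /predU1P[->|/zF].
  have [Dty|nDty] := pselect (D t y).
    by apply: filterS (proj1 (yU t) Dty) => z.
  have [/yU//|nDt] := in_ultra_setVsetC (D t) UU.
  by apply: filterS nDt => z.
have U0 : U [set z | phi z = 0].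
  by apply: subU; exists [::] => // z [].
have [z [zF z0]] := filter_ex (filterI UF U0).
exact: HF zF z0.
Qed.

Definition spring := {phi : X -> K | spring_pred phi}.
HB.instance Definition _ := SubChoice.on spring.
HB.instance Definition _ := GRing.SubChoice_isSubComPzRing.Build
  (X -> K) spring_pred spring spring_pred_subring.

Implicit Types (a b c : spring) (Q : set spring).

Definition mk_spring phi h (hp : has_symbol phi h) : spring :=
  exist (fun phi => is_true (spring_pred phi)) phi (asboolT (ex_intro _ h hp)).

Lemma spring_symbol a : exists h, has_symbol (val a) h.
Proof. exact/asboolP/(valP a). Qed.

Lemma val_spring1 x : val (1 : spring) x = 1. Proof. by []. Qed.

Lemma val_springD a b x : val (a + b) x = val a x + val b x. Proof. by []. Qed.

Lemma val_springM a b x : val (a * b) x = val a x * val b x. Proof. by []. Qed.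

Lemma val_springX a n x : val (a ^+ n) x = val a x ^+ n.
Proof.
elim: n => [|n IH]; first by rewrite !expr0.
by rewrite !exprS val_springM IH.
Qed.

Lemma spring_dvdX a b : (forall x, val a x = 0 -> val b x = 0) ->
  exists n c, (0 < n)%N /\ b ^+ n = c * a.
Proof.
move=> ab; have [h ha] := spring_symbol a; have [k kb] := spring_symbol b.
have [n n0 H] := symbol_divX ha kb ab.
exists n, (mk_spring H); split => //; apply: val_inj; apply/funext => x.
rewrite val_springX val_springM /=.
have [a0|a0] := eqVneq (val a x) 0; last by rewrite divfK.
by rewrite (ab _ a0) a0 mulr0 expr0n eqn0Ngt n0.
Qed.

Lemma prime_vanish Q a b : is_prime Q -> Q a ->
  (forall x, val a x = 0 -> val b x = 0) -> Q b.
Proof.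
move=> [[_ _ QM] Q1 Qpr] Qa /spring_dvdX[n [c [_ e]]].
have : Q (b ^+ n) by rewrite e; apply: QM.
elim: n {e} => [|n IH]; first by rewrite expr0.
by rewrite exprS => /Qpr[//|].
Qed.

Definition coordf s : X -> K := fun x => if `[< D s x >] then tf (var B s) else 0.

Lemma coordf_symbol s : has_symbol (coordf s) (tf (var B s)).
Proof.
move=> x; rewrite /coordf; case: asboolP => Dsx.
  split=> [|y _]; last by rewrite subrr; apply: ev_pos0.
  apply: res_field_poly => m; rewrite supp_var => /fset1P ->.
  by rewrite wtU off0.
split=> [|y _]; first exact: res_field0.
rewrite subr0; exists 0%N => N _; exists (var B s), 1, 0%N; split.
- by rewrite rmorph1 divr1.
- apply/allP => m; rewrite supp_var => /fset1P ->.
  by rewrite wtU (off1 Dsx) add0n leq_addl.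
- exact: val_ge_one.
Qed.

Definition coord s : spring := mk_spring (coordf_symbol s).

Lemma coord_neq0 s x : val (coord s) x != 0 <-> D s x.
Proof.
rewrite /= /coordf; case: asboolP => Dsx; last by rewrite eqxx.
split=> // _; rewrite tf_eq0// -supp_eq0 supp_var.
by apply/fset0Pn; exists (ucm s); apply/fset1P.
Qed.

Lemma coord_eq0 s x : val (coord s) x = 0 <-> ~ D s x.
Proof.
split=> [c0 /coord_neq0/eqP//|nDs].
by apply/eqP; apply: contrapT => /negP/coord_neq0.
Qed.

Lemma supp_sum_var (F : seq S) : uniq F ->
  supp (\sum_(s <- F) var B s) =i [seq ucm s | s <- F].
Proof.
elim: F => [|t F IH] /=; first by rewrite big_nil supp0 => _ m; rewrite !inE.
move=> /andP[tF /IH {}IH] m; rewrite big_cons suppD; last first.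
  apply/fdisjointP => m'; rewrite supp_var => /fset1P ->; rewrite IH.
  apply/negP => /mapP[s sF /(congr1 (fun m : {cmonom S} => m t))].
  by rewrite !cmU eqxx; case: eqP => // st; rewrite -st sF in tF.
by rewrite in_fsetU supp_var in_fset1 IH inE.
Qed.

(** The terms that do not vanish at [x] are distinct variables and cannot cancel. Sums of
    coordinates thus cut out finite unions of the [D s]. *)
Lemma sum_coord_neq0 (F : seq S) x : uniq F ->
  (exists2 s, s \in F & D s x) -> val (\sum_(s <- F) coord s) x != 0.
Proof.
move=> uF [s sF Dsx].
have -> : val (\sum_(s <- F) coord s) x =
    tf (\sum_(s <- [seq s <- F | `[< D s x >]]) var B s).
  elim: (F) => [|t F' IH] /=; first by rewrite !big_nil rmorph0.
  rewrite big_cons val_springD IH /= /coordf.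
  by case: asboolP => _; rewrite ?big_cons ?rmorphD ?add0r.
rewrite tf_eq0// -supp_eq0; apply/fset0Pn; exists (ucm s).
rewrite supp_sum_var ?filter_uniq//; apply: map_f.
by rewrite mem_filter sF andbT; apply/asboolP.
Qed.

Lemma prod_coord_neq0 (F : seq S) x :
  val (\prod_(s <- F) coord s) x != 0 <-> forall s, s \in F -> D s x.
Proof.
elim: F => [|t F IH]; first by rewrite big_nil oner_eq0.
rewrite big_cons val_springM.
rewrite mulf_eq0 negb_or; split=> [/andP[/coord_neq0 Dt /IH DF] s|H].
  by rewrite inE => /predU1P[->|/DF].
apply/andP; split; first exact/coord_neq0/H/mem_head.
by apply/IH => s sF; apply: H; rewrite inE sF orbT.
Qed.

Lemma prime_prod Q (F : seq S) : is_prime Q -> (forall s, s \in F -> ~ Q (coord s)) ->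
  ~ Q (\prod_(s <- F) coord s).
Proof.
move=> [_ Q1 Qpr]; elim: F => [|t F IH] H; first by rewrite big_nil.
rewrite big_cons => /Qpr[]; first exact/H/mem_head.
by apply: IH => s sF; apply: H; rewrite inE sF orbT.
Qed.

Lemma ideal_sum Q (F : seq S) : is_ideal Q -> (forall s, s \in F -> Q (coord s)) ->
  Q (\sum_(s <- F) coord s).
Proof.
move=> [Q0 QD _]; elim: F => [|t F IH] H; first by rewrite big_nil.
rewrite big_cons; apply: QD; first exact/H/mem_head.
by apply: IH => s sF; apply: H; rewrite inE sF orbT.
Qed.

(** Any finite part of these conditions holds at some point: otherwise a product of coordinates
    outside [Q] would vanish wherever a sum of coordinates in [Q] does, and would lie in [Q]. The
    point is an ultrafilter limit. *)
Lemma prime_coords Q : is_prime Q ->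
  exists x, forall s, Q (coord s) <-> ~ D s x.
Proof.
move=> Qpr; have [Qid _ _] := Qpr.
pose Dom := [set F : seq S * seq S | (forall s, s \in F.1 -> Q (coord s)) /\
  (forall s, s \in F.2 -> ~ Q (coord s))].
pose E (F : seq S * seq S) := [set x | (forall s, s \in F.1 -> ~ D s x) /\
  (forall s, s \in F.2 -> D s x)].
have : ProperFilter (filter_from Dom E).
  apply: filter_from_proper; last first.
    move=> [F1 F2] [/= QF1 QF2]; apply: contrapT => nE.
    apply: (prime_prod Qpr QF2); apply: prime_vanish (ideal_sum (F := undup F1) Qid _) _ => //.
      by move=> s; rewrite mem_undup; apply: QF1.
    move=> x s0; apply/eqP; apply: contrapT => /negP/prod_coord_neq0 DF2.
    apply: nE; exists x; split=> // s sF1 Dsx.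
    have /eqP := s0; apply/negP; apply: sum_coord_neq0; first exact: undup_uniq.
    by exists s; rewrite ?mem_undup.
  apply: filter_from_filter; first by exists ([::], [::]).
  move=> [F1 F2] [G1 G2] [/= f1 f2] [/= g1 g2]; exists (F1 ++ G1, F2 ++ G2).
    by split=> s /=; rewrite mem_cat => /orP[]; auto.
  move=> x [/= h1 h2]; split; split=> s /= sF; (apply: h1 || apply: h2);
    by rewrite mem_cat sF ?orbT.
move=> /ultraFilterLemma[U [UU subU]]; have [x xU] := D_ultra UU; exists x => s.
have [Qs|nQs] := pselect (Q (coord s)); split=> //.
- move=> _ /xU Us; have Us' : U (~` D s).
    apply: subU; exists ([:: s], [::]); first by split=> t //=; rewrite inE => /eqP ->.
    by move=> y [/= + _]; apply; apply: mem_head.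
  by have [y []] := filter_ex (filterI Us Us').
- case; apply/xU/subU; exists ([::], [:: s]).
    by split=> t //=; rewrite inE => /eqP ->.
  by move=> y [/= _]; apply; apply: mem_head.
Qed.

Lemma prime_point Q : is_prime Q -> exists x, Q = [set a | val a x = 0].
Proof.
move=> Qpr; have [x xQ] := prime_coords Qpr; exists x.
have nQ s : D s x -> ~ Q (coord s) by move=> Ds /xQ.
apply/seteqP; split=> a /=.
(* If [a] is nonzero at [x], it is nonzero on a basic neighbourhood of [x]; the product of the
   corresponding coordinates vanishes with [a], so it falls into [Q]. *)
- move=> Qa; apply/eqP; apply: contrapT => /negP ax.
  have [h ha] := spring_symbol a.
  have [F Fx HF] := D_nbhs (symbol_open ha) ax.
  apply: (@prime_prod Q F Qpr) => [s /Fx /nQ//|]; apply: prime_vanish Qa _ => // y ay.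
  apply/eqP; apply: contrapT => /negP/prod_coord_neq0/HF /=.
  by rewrite ay eqxx.
(* Membership in the finitely many [D s] with [s] in [F] decides whether [a] vanishes, so [a] times
   the coordinates from [F2] vanishes wherever the sum of those from [F1] does. *)
- move=> ax; apply: contrapT => nQa; have [h ha] := spring_symbol a.
  have [F HF] := symbol_constructible ha.
  pose F1 := undup [seq s <- F | `[< ~ D s x >]].
  pose F2 := [seq s <- F | `[< D s x >]].
  have [_ _ Qp] := Qpr.
  suff /Qp[|//] : Q ((\prod_(s <- F2) coord s) * a).
    by apply: prime_prod => // s; rewrite mem_filter => /andP[/asboolP /nQ].
  apply: (@prime_vanish _ (\sum_(s <- F1) coord s)) => //.
    apply: ideal_sum; first by case: Qpr.
    by move=> s; rewrite mem_undup mem_filter => /andP[/asboolP nD _]; apply/xQ.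
  move=> y sy; rewrite val_springM.
  apply/eqP; rewrite mulf_eq0; apply: contrapT => /negP; rewrite negb_or.
  move=> /andP[/prod_coord_neq0 DF2 /eqP ay]; apply: ay; apply: HF ax => s sF.
  split=> [Dsx|Dsy]; first by apply: DF2; rewrite mem_filter sF andbT; apply/asboolP.
  apply: contrapT => nDsx; move/eqP: sy; apply/negP; apply: sum_coord_neq0.
    exact: undup_uniq.
  by exists s => //; rewrite mem_undup mem_filter sF andbT; apply/asboolP.
Qed.

Lemma point_prime x : is_prime [set a : spring | val a x = 0].
Proof.
split.
- split=> // [a b a0 b0|a b b0]; rewrite /mkset.
    by rewrite val_springD a0 b0 addr0.
  by rewrite val_springM b0 mulr0.
- by rewrite /mkset val_spring1 => /eqP; rewrite oner_eq0.
- move=> a b; rewrite /mkset val_springM => /eqP.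
  by rewrite mulf_eq0 => /orP[/eqP|/eqP]; [left|right].
Qed.

Lemma spring_spectral : spectral X.
Proof.
exists (spring : comPzRingType).
pose f x := MkSpec (point_prime x).
have gP (P : Spec (spring : comPzRingType)) : exists x, f x = P.
  have [x PE] := prime_point (prime_setP P); exists x.
  case: P PE => P Ppr /= PE; rewrite /f; move: (point_prime x); rewrite -PE => Ppr'.
  by congr MkSpec; apply: Prop_irrelevance.
have [g fg] := choice gP.
have finj x y : f x = f y -> x = y.
  move=> fxy; apply: D_sep => s.
  have e : (val (coord s) x = 0) = (val (coord s) y = 0).
    exact: (congr1 (fun P : Spec (spring : comPzRingType) => prime_set P (coord s)) fxy).
  have := coord_eq0 s x; have := coord_eq0 s y; rewrite e => cy cx.
  by split=> Ds; apply: contrapT => /[dup] nDs; [move=> /cy/cx|move=> /cx/cy].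
exists f, g; split.
- apply/continuousP => U [Z ->].
  rewrite (_ : _ @^-1` _ = \bigcup_(a in Z) [set x | val a x != 0]).
    by apply: bigcup_open => a _; have [h] := spring_symbol a; apply: symbol_open.
  apply/seteqP; split=> x.
    by move=> /= /existsNP[a /not_implyP[Za /eqP nz]]; exists a.
  by move=> [a Za /eqP nz] /= /(_ _ Za).
- move=> P U; rewrite nbhsE => -[V [oV VgP] VU].
  have [F FP HF] := D_nbhs oV VgP.
  apply: (@filterS _ _ _ [set P' | ~ prime_set P' (\prod_(s <- F) coord s)]).
    move=> P' /= nP'; apply/VU/HF/prod_coord_neq0/eqP => e; apply: nP'.
    by rewrite -(fg P').
  apply: open_nbhs_nbhs; split.
    exists [set \prod_(s <- F) coord s].
    by apply/seteqP; split=> P' /= h => [h'|h']; apply: h; [exact: h'|move=> _ ->].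
  move=> /=; rewrite -(fg P) /= => /eqP; apply/negP; exact/prod_coord_neq0.
- by move=> x; apply: finj; rewrite fg.
- exact: fg.
Qed.

End Spring.

(** The sufficiency half of Hochster's theorem, phrased with a subbasis; the ultrafilter condition
    expresses compactness of the constructible topology. *)
Theorem subbasis_spectral (X : topologicalType) (S : choiceType) (D : S -> set X) :
  (forall s, open (D s)) ->
  (forall (U : set X) x, open U -> U x ->
    exists2 F : seq S, (forall s, s \in F -> D s x) &
      forall y, (forall s, s \in F -> D s y) -> U y) ->
  (forall x y, (forall s, D s x <-> D s y) -> x = y) ->
  (forall U : set_system X, UltraFilter U -> exists x, forall s, D s x <-> U (D s)) ->
  spectral X.
Proof.
move=> Dopen Dnbhs Dsep Dultra; have [B] := monom_domain_exists S.
apply: (@spring_spectral X S D B {fraction B} (@FracField.tofrac B)) => //.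
- by move=> f g /eqP; rewrite tofrac_eq => /eqP.
- exact: fraction_repr.
Qed.

(** * Ideals of Noetherian rings *)

Section Ideals.
Variable R : comPzRingType.
Implicit Types (I J M P Q a m p q : set R) (x y z r s t e : R).

Lemma idealN I x : is_ideal I -> I x -> I (- x).
Proof. by move=> [_ _ IM] /(IM (-1)); rewrite mulN1r. Qed.

Lemma idealB I x y : is_ideal I -> I x -> I y -> I (x - y).
Proof. by move=> /[dup] Iid [_ ID _] Ix /(idealN Iid); apply: ID. Qed.

Lemma idealMr I x r : is_ideal I -> I x -> I (x * r).
Proof. by move=> [_ _ IM] Ix; rewrite mulrC; apply: IM. Qed.

Lemma idealBK I x y : is_ideal I -> I y -> I (x - y) -> I x.
Proof. by move=> [_ ID _] Iy /ID/(_ Iy); rewrite subrK. Qed.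

Lemma ideal_eqmodX I x y n : is_ideal I -> I (x - y) -> I (x ^+ n - y ^+ n).
Proof.
move=> Iid Ixy; have [I0 ID IM] := Iid; elim: n => [|n IH]; first by rewrite subrr.
have -> : x ^+ n.+1 - y ^+ n.+1 = x * (x ^+ n - y ^+ n) + y ^+ n * (x - y).
  by rewrite !exprS; ring.
by apply: ID; apply: IM.
Qed.

Lemma ideal_unit_pow I z n : is_ideal I -> I ((1 - z) ^+ n) -> exists r, I (1 - r * z).
Proof.
move=> [I0 ID IM] In.
suff [r e] : exists r, (1 - z) ^+ n = 1 - r * z by exists r; rewrite -e.
elim: n {In} => [|n [r e]]; first by exists 0; rewrite mul0r subr0.
by exists (1 + r - r * z); rewrite exprS e; ring.
Qed.

Definition extend I x := [set z | exists i r, I i /\ z = i + r * x].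

Lemma extend_ideal I x : is_ideal I -> is_ideal (extend I x).
Proof.
move=> [I0 ID IM]; split.
- by exists 0, 0; rewrite mul0r addr0.
- move=> _ _ [i [r [Ii ->]]] [j [t [Ij ->]]]; exists (i + j), (r + t).
  by split; [apply: ID|ring].
- move=> s _ [i [r [Ii ->]]]; exists (s * i), (s * r); split; [exact: IM|ring].
Qed.

Lemma sub_extend I x : is_ideal I -> I `<=` extend I x.
Proof. by move=> _ i Ii; exists i, 0; rewrite mul0r addr0. Qed.

Lemma mem_extend I x : is_ideal I -> extend I x x.
Proof. by move=> [I0 _ _]; exists 0, 1; rewrite add0r mul1r. Qed.

(** Maximality is encoded as the quotient being a field. *)
Definition maximal_ideal m :=
  [/\ is_ideal m, ~ m 1 & forall x, ~ m x -> exists r, m (1 - r * x)].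

Lemma maximal_prime m : maximal_ideal m -> is_prime m.
Proof.
move=> [mid m1 mmax]; split => // x y mxy.
have [mx|/mmax[r mr]] := pselect (m x); [by left|right].
have -> : y = y * (1 - r * x) + r * (x * y) by ring.
by case: mid => _ mD mM; apply: mD; apply: mM.
Qed.

Lemma maximal_eq m p : maximal_ideal m -> is_ideal p -> ~ p 1 -> m `<=` p -> p = m.
Proof.
move=> [mid m1 mmax] pid p1 mp; apply/seteqP; split=> // x px.
apply: contrapT => /mmax[r mr]; apply: p1; apply: (idealBK pid _ (mp _ mr)).
by case: pid => _ _; apply.
Qed.

Lemma prime_primary p : is_prime p -> is_primary p.
Proof.
by move=> [pid p1 ppr]; split=> // x y /ppr[]; [left|right; exists 1%N; rewrite expr1].
Qed.

Lemma primeX p x n : is_prime p -> p (x ^+ n) -> p x.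
Proof.
move=> [_ p1 ppr]; elim: n => [|n IH]; first by rewrite expr0.
by rewrite exprS => /ppr[].
Qed.

Lemma ideal_bigcup (F : set (set R)) : F !=set0 -> F `<=` @is_ideal R ->
  total_on F subset -> is_ideal (\bigcup_(I in F) I).
Proof.
move=> [I0 FI0] Fid tot; split.
- by exists I0 => //; case: (Fid _ FI0).
- move=> x y [I FI Ix] [J FJ Jy]; have [IJ|JI] := tot _ _ FI FJ.
    by exists J => //; case: (Fid _ FJ) => _ JD _; apply: JD => //; apply: IJ.
  by exists I => //; case: (Fid _ FI) => _ ID _; apply: ID => //; apply: JI.
- move=> r x [I FI Ix]; exists I => //.
  by case: (Fid _ FI) => _ _; apply.
Qed.

Lemma chain_seq (F : set (set R)) (L : seq R) : F !=set0 -> total_on F subset ->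
  [set` L] `<=` \bigcup_(I in F) I -> exists2 I, F I & [set` L] `<=` I.
Proof.
move=> [I0 FI0] tot; elim: L => [|x L IH] LF; first by exists I0.
have [|I FI LI] := IH; first by move=> y yL; apply: LF; rewrite /= inE [y \in L]yL orbT.
have [J FJ Jx] : (\bigcup_(I in F) I) x by apply: LF; rewrite /= mem_head.
have [IJ|JI] := tot _ _ FI FJ.
  by exists J => // y; rewrite /= inE => /predU1P[->//|yL]; apply/IJ/LI.
by exists I => // y; rewrite /= inE => /predU1P[->|yL]; [apply: JI|apply: LI].
Qed.

Hypothesis noethR : noetherian R.

Lemma noetherian_max (C : set (set R)) : C `<=` @is_ideal R -> C !=set0 ->
  exists2 M, C M & forall J, C J -> M `<=` J -> J = M.
Proof.
move=> Cid [I CI].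
(* Zorn's lemma also asks for the union of the empty chain, so the empty set is adjoined to [C]; it
   is not maximal, since [C] has a member and that contains 0. *)
have [F FC tot|M [CM Mmax]] := @Zorn_bigcup R (C `|` [set set0]).
  have [F0|nF0] := pselect ((F `&` C) !=set0); last first.
    right; apply/seteqP; split=> // x [J FJ Jx].
    case: (FC _ FJ) => [CJ|J0]; last by rewrite J0 in Jx.
    by apply: nF0; exists J.
  have -> : \bigcup_(J in F) J = \bigcup_(J in F `&` C) J.
    apply/seteqP; split=> x [J FJ Jx]; last by exists J => //; case: FJ.
    case: (FC _ FJ) => [CJ|J0]; last by rewrite J0 in Jx.
    by exists J.
  have totC : total_on (F `&` C) subset by move=> J K [FJ _] [FK _]; apply: tot.
  have Uid := ideal_bigcup F0 (fun J (h : (F `&` C) J) => Cid J h.2) totC.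
  have [L LE] := noethR Uid.
  have [J [FJ CJ] LJ] : exists2 J, (F `&` C) J & [set` L] `<=` J.
    by apply: chain_seq => //; rewrite {}LE; apply: sub_gen_smallest.
  left; suff -> : \bigcup_(J in F `&` C) J = J by [].
  apply/seteqP; split=> x Ux; last by exists J.
  by rewrite LE in Ux; apply: Ux; split=> //; apply: Cid.
case: CM => [CM|M0]; last first.
  exfalso; apply: (Mmax I); last by left.
  by rewrite M0; split=> // /(_ 0); apply; case: (Cid _ CI).
exists M => // J CJ MJ; apply: contrapT => nJM; apply: (Mmax J); last by left.
by split=> // JM; apply: nJM; apply/seteqP.
Qed.

Lemma exists_maximal I : is_ideal I -> ~ I 1 ->
  exists2 m, maximal_ideal m & I `<=` m.
Proof.
move=> Iid I1.
have [||m [mid Im m1] mmax] :=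
    @noetherian_max [set J | [/\ is_ideal J, I `<=` J & ~ J 1]].
- by move=> J [].
- by exists I; split.
exists m => //; split=> // x nmx; apply: contrapT => nex; apply: nmx.
rewrite -(mmax (extend m x)); first exact: mem_extend.
  split; [exact: extend_ideal|exact: subset_trans Im (sub_extend x mid)|].
  move=> [i [r [mi e]]]; apply: nex; exists r.
  by rewrite e addrK.
exact: sub_extend.
Qed.

(** An ideal maximal among those that contain [I] and miss [S] is prime. *)
Lemma exists_prime_disjoint I (S : set R) : is_ideal I -> S 1 ->
  (forall x y, S x -> S y -> S (x * y)) -> (forall x, S x -> ~ I x) ->
  exists2 p, is_prime p /\ I `<=` p & forall x, S x -> ~ p x.
Proof.
move=> Iid S1 SM SI.
have [||p [pid Ip pS] pmax] :=
    @noetherian_max [set J | [/\ is_ideal J, I `<=` J & forall x, S x -> ~ J x]].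
- by move=> J [].
- by exists I; split.
exists p => //; split=> //; split=> //; first exact: pS.
have meets x : ~ p x -> exists2 s, S s & extend p x s.
  move=> npx; apply: contrapT => nex; apply: npx.
  rewrite -(pmax (extend p x)); first exact: mem_extend.
    split; [exact: extend_ideal|exact: subset_trans Ip (sub_extend x pid)|].
    by move=> s Ss ps; apply: nex; exists s.
  exact: sub_extend.
move=> x y pxy; apply: contrapT => /not_orP[/meets[s Ss [i [r [pi se]]]]].
move=> /meets[t St [j [k [pj te]]]]; apply: (pS _ (SM _ _ Ss St)).
have -> : s * t = (j + k * y) * i + r * x * j + r * k * (x * y).
  by rewrite se te; ring.
by case: pid => p0 pD pM; apply: (pD _ _ (pD _ _ _ _)); apply: pM.
Qed.

(** For maximal [m] these are the primary ideals with radical [m]. *)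
Definition coprimary m q := [/\ is_ideal q, q `<=` m & forall y, m y -> exists n, q (y ^+ n)].

Lemma coprimary_unit m q v : maximal_ideal m -> coprimary m q -> ~ m v ->
  exists r, q (1 - r * v).
Proof.
move=> [mid m1 mmax] [qid qm qp] /mmax[r mr]; have [n qn] := qp _ mr.
by have [t] := ideal_unit_pow qid qn; rewrite mulrA; exists (t * r).
Qed.

Lemma coprimary_cancel m q u v : maximal_ideal m -> coprimary m q -> ~ m v ->
  q (u * v) -> q u.
Proof.
move=> mm qm nv quv; have [r qr] := coprimary_unit mm qm nv.
case: qm => [[q0 qD qM] _ _].
have -> : u = u * (1 - r * v) + r * (u * v) by ring.
by apply: qD; apply: qM.
Qed.

Lemma coprimary_primary m q : maximal_ideal m -> coprimary m q -> is_primary q.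
Proof.
move=> mm /[dup] qm [qid qsub qp]; split=> //.
  by move=> /qsub; case: mm.
move=> u v quv; have [mv|nv] := pselect (m v); first by right; apply: qp.
by left; apply: coprimary_cancel mm qm nv quv.
Qed.

Lemma coprimaryI m q1 q2 : coprimary m q1 -> coprimary m q2 -> coprimary m (q1 `&` q2).
Proof.
move=> [[z1 D1 M1] s1 p1] [[z2 D2 M2] s2 p2]; split.
- split=> //; first by move=> x y [? ?] [? ?]; split; auto.
  by move=> r x [? ?]; split; auto.
- by move=> x [/s1].
- move=> y my; have [n1 h1] := p1 _ my; have [n2 h2] := p2 _ my.
  exists (n1 + n2)%N; rewrite exprD; split; last exact: M2.
  by rewrite mulrC; apply: M1.
Qed.

Lemma coprimary_maximal m : maximal_ideal m -> coprimary m m.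
Proof. by move=> [mid _ _]; split=> // y my; exists 1%N; rewrite expr1. Qed.

(* The contraction to the ring of the extension of [a] to the localization at [m]. *)
Definition local_closure a m := [set x | exists2 s, ~ m s & a (s * x)].

(* This replaces Krull's intersection theorem: an ideal [q] maximal among those
   that contain [a] and [m x] but not [x] is [m]-primary. *)
Lemma exists_coprimary a m x : is_ideal a -> maximal_ideal m ->
  ~ local_closure a m x -> exists q, [/\ coprimary m q, a `<=` q & ~ q x].
Proof.
move=> aid mm nx; have [mid m1 mmax] := mm; have [m0 mD mM] := mid.
have [a0 aD aM] := aid.
pose ax := [set z | exists i t, [/\ a i, m t & z = i + t * x]].
have [||q [qid aq mq nqx] qmax] := @noetherian_max
    [set J | [/\ is_ideal J, a `<=` J, (forall y, m y -> J (y * x)) & ~ J x]].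
- by move=> J [].
- exists ax; split.
  + split.
    * by exists 0, 0; rewrite mul0r addr0.
    * move=> _ _ [i [t [ai mt ->]]] [j [k [aj mk ->]]]; exists (i + j), (t + k).
      by split; [exact: aD|exact: mD|ring].
    * move=> r _ [i [t [ai mt ->]]]; exists (r * i), (r * t).
      by split; [exact: aM|exact: mM|ring].
  + by move=> i ai; exists i, 0; rewrite mul0r addr0.
  + by move=> y my; exists 0, y; rewrite add0r.
  (* As in Nakayama's lemma: [x = i + t * x] puts [(1 - t) * x] in [a], with [1 - t] outside [m]. *)
  + move=> [i [t [ai mt e]]]; apply: nx; exists (1 - t).
      by move=> h; apply: m1; apply: idealBK mid mt h.
    by rewrite mulrBl mul1r [X in X - _]e addrK.
have [q0 qD qM] := qid.
(* Every ideal strictly above [q] contains [x]. Membership of [x] in [extend q u] gives [v * x] in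
   [q]; membership in [extend q (v ^+ n)], where the colon ideals of [q] by powers of [v] are
   stationary from [n] on, then gives [x] in [q]. *)
have qpr u v : q (u * v) -> q u \/ exists n, q (v ^+ n).
  move=> quv; apply: contrapT => /not_orP[nu nv].
  have grow y : ~ q y -> extend q y x.
    move=> ny; apply: contrapT => nex; apply: ny.
    rewrite -(qmax (extend q y)); first exact: mem_extend.
      split=> //; [exact: extend_ideal|exact: subset_trans aq (sub_extend y qid)|].
      by move=> z mz; apply: sub_extend qid _ (mq _ mz).
    exact: sub_extend.
  have [i [r [qi xi]]] := grow _ nu.
  have [||_ [n _ <-] cmax] := @noetherian_max [set [set z | q (z * v ^+ n)] | n in setT].
  - move=> _ [n _ <-]; split=> /= [|y z qy qz|s y qy].
    + by rewrite mul0r.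
    + by rewrite mulrDl; apply: qD.
    + by rewrite -mulrA; apply: qM.
  - by eexists; exists 0%N.
  have {}cmax z : q (z * v ^+ n.+1) -> q (z * v ^+ n).
    have e : [set z | q (z * v ^+ n.+1)] = [set z | q (z * v ^+ n)].
      apply: cmax; first by exists n.+1.
      by move=> y /= qy; rewrite exprSr mulrA; apply: idealMr.
    by move=> h; rewrite -[q _]/([set z | q (z * v ^+ n)] z) -e.
  have [j [s [qj xj]]] := grow (v ^+ n) (fun h => nv (ex_intro _ n h)).
  apply: nqx; rewrite xj; apply: (qD) => //; apply: cmax.
  have -> : s * v ^+ n.+1 = v * i + r * (u * v) - v * j.
    have : v * (s * v ^+ n) = v * (x - j) by rewrite {1}xj addrC addKr.
    rewrite exprS => e; rewrite mulrCA e {1}xi; ring.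
  by apply: idealB => //; [apply: qD|]; apply: qM.
exists q; split=> //; split=> //.
- move=> z qz; apply: contrapT => /mmax[r mr]; apply: nqx.
  have -> : x = (1 - r * z) * x + r * x * z by ring.
  by apply: qD; [apply: mq|apply: qM].
- by move=> y /mq; rewrite mulrC => /qpr[/nqx|].
Qed.

End Ideals.

(** * Product decompositions from sobriety *)

(* The ring [e R] with unit [e]; the proof is an argument because the ring
   structure depends on it. *)
Definition corner (R : comPzRingType) (e : R) (_ : e * e = e) :=
  {x : R | e * x == x}.

Section Corner.
Variables (R : comPzRingType) (e : R) (ee : e * e = e).

Lemma corner_zmod_closed : zmod_closed (fun x : R => e * x == x).
Proof.
split=> [|x y]; rewrite -!topredE /=; first by rewrite mulr0.
by move=> /eqP ex /eqP ey; rewrite mulrBr ex ey.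
Qed.

HB.instance Definition _ := SubChoice.on (corner ee).
HB.instance Definition _ := GRing.SubChoice_isSubZmodule.Build
  R _ (corner ee) corner_zmod_closed.

Lemma cornerP (x : corner ee) : e * val x = val x.
Proof. exact/eqP/(valP x). Qed.

Lemma proj_subproof x : e * (e * x) == e * x.
Proof. by rewrite mulrA ee. Qed.

Definition proj x : corner ee := exist _ (e * x) (proj_subproof x).

Definition corner_mul (x y : corner ee) := proj (val x * val y).

Lemma val_corner_mul x y : val (corner_mul x y) = val x * val y.
Proof. by rewrite /= mulrA cornerP. Qed.

Fact corner_mulA : associative corner_mul.
Proof. by move=> x y z; apply: val_inj; rewrite !val_corner_mul mulrA. Qed.

Fact corner_mulC : commutative corner_mul.
Proof. by move=> x y; apply: val_inj; rewrite !val_corner_mul mulrC. Qed.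

Fact corner_mul1 : left_id (proj 1) corner_mul.
Proof. by move=> x; apply: val_inj; rewrite val_corner_mul /= mulr1 cornerP. Qed.

Fact corner_mulDl : left_distributive corner_mul +%R.
Proof.
by move=> x y z; apply: val_inj; rewrite val_corner_mul mulrDl -!val_corner_mul.
Qed.

HB.instance Definition _ := GRing.Zmodule_isComPzRing.Build (corner ee)
  corner_mulA corner_mulC corner_mul1 corner_mulDl.

Lemma val_cornerM (x y : corner ee) : val (x * y) = val x * val y.
Proof. exact: val_corner_mul. Qed.

Lemma val_cornerD (x y : corner ee) : val (x + y) = val x + val y.
Proof. by []. Qed.

Lemma val_corner1 : val (1 : corner ee) = e.
Proof. by rewrite /= mulr1. Qed.

Lemma val_corner0 : val (0 : corner ee) = 0.
Proof. by []. Qed.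

Lemma val_proj x : val (proj x) = e * x. Proof. by []. Qed.

Lemma val_projK (y : corner ee) : proj (val y) = y.
Proof. by apply: val_inj; rewrite val_proj cornerP. Qed.

Fact proj_zmod : zmod_morphism proj.
Proof. by move=> x y; apply: val_inj; rewrite /= mulrBr. Qed.
HB.instance Definition _ := GRing.isZmodMorphism.Build R (corner ee) proj proj_zmod.

Fact proj_monoid : monoid_morphism proj.
Proof.
split; first by [].
by move=> x y; apply: val_inj; rewrite val_cornerM !val_proj mulrACA ee.
Qed.
HB.instance Definition _ := GRing.isMonoidMorphism.Build R (corner ee) proj proj_monoid.

Definition pull (P : set (corner ee)) : set R := [set x | P (proj x)].

Lemma pull_prime P : is_prime P -> is_prime (pull P) /\ ~ pull P e.
Proof.
move=> [[P0 PD PM] P1 Ppr]; split; last first.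
  by rewrite /pull /= => Pe; apply: P1; rewrite -(val_projK 1) val_corner1.
split.
- split.
  + by rewrite /pull /= rmorph0.
  + by move=> x y Px Py; rewrite /pull /= rmorphD; apply: PD.
  + by move=> x y Py; rewrite /pull /= rmorphM; apply: PM.
- by rewrite /pull /= rmorph1.
- by move=> x y; rewrite /pull /= rmorphM => /Ppr.
Qed.

Lemma pull_proper (P Q : set (corner ee)) : P `<` Q -> pull P `<` pull Q.
Proof.
move=> [PQ QP]; split=> [x /PQ//|QP']; apply: QP => y Qy.
by rewrite -(val_projK y); apply: QP'; rewrite /pull /= val_projK.
Qed.

Definition push (p : set R) : set (corner ee) := [set y | p (val y)].

Lemma push_prime p : is_prime p -> ~ p e -> is_prime (push p).
Proof.
move=> [[p0 pD pM] p1 ppr] pe; split.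
- split.
  + by rewrite /push /mkset val_corner0.
  + by move=> x y px py; rewrite /push /mkset val_cornerD; apply: pD.
  + by move=> x y py; rewrite /push /mkset val_cornerM; apply: pM.
- by rewrite /push /mkset val_corner1.
- by move=> x y; rewrite /push /mkset val_cornerM => /ppr.
Qed.

Lemma push_proper p q : is_prime p -> is_prime q -> ~ p e -> p `<` q -> push p `<` push q.
Proof.
move=> [_ _ ppr] [[_ _ qM] _ _] pe [pq qp]; split=> [y /pq//|qp']; apply: qp => x qx.
have : push p (proj x) by apply: qp'; rewrite /push /mkset val_proj; apply: qM.
by rewrite /push /mkset val_proj => /ppr[].
Qed.
End Corner.

Lemma set_proper_trans (T : Type) (X Y Z : set T) : X `<` Y -> Y `<` Z -> X `<` Z.
Proof.
move=> [XY YX] [YZ _]; split; first exact: subset_trans YZ.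
by move=> ZX; apply: YX; apply: subset_trans ZX.
Qed.

(** * Krull dimension zero and one in terms of short chains of primes *)

Section Chains.
Variable A : comPzRingType.

Lemma chain2 (P Q : Spec A) : P `<` Q -> exists p : 'I_2 -> Spec A, prime_chain p.
Proof.
move=> PQ; exists (fun i => if i == 0 :> nat then P else Q).
by move=> -[[|[|i]] hi] [[|[|j]] hj].
Qed.

Lemma chain3 (P Q T : Spec A) : P `<` Q -> Q `<` T ->
  exists p : 'I_3 -> Spec A, prime_chain p.
Proof.
move=> PQ QT.
exists (fun i => if i == 0 :> nat then P else if i == 1 :> nat then Q else T).
have PT : P `<` T by apply: set_proper_trans PQ QT.
by move=> -[[|[|[|i]]] hi] [[|[|[|j]]] hj].
Qed.

Lemma krull_dim0 : has_krull_dim A 0 <->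
  inhabited (Spec A) /\ forall P Q : Spec A, ~ (P `<` Q).
Proof.
split=> [[[p _] h]|[[P] h]].
  split; first by exact: inhabits (p ord0).
  by move=> P Q /chain2[c /h].
split; first by exists (fun=> P) => -[[|i] hi] [[|j] hj].
move=> [//|n] p pc; case: (h (p ord0) (p ord_max)); exact: pc.
Qed.

Lemma krull_dim1 : has_krull_dim A 1 <->
  (exists P Q : Spec A, P `<` Q) /\ forall P Q T : Spec A, P `<` Q -> ~ (Q `<` T).
Proof.
split=> [[[p pc] h]|[[P [Q PQ]] h]].
  split; first by exists (p ord0), (p ord_max); apply: pc.
  by move=> P Q T PQ /(chain3 PQ)[c /h].
split; first exact: chain2 PQ.
move=> [|[|n]] p pc //; case: (h (p ord0) (p (inord 1)) (p ord_max)); apply: pc;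
  by rewrite inordK.
Qed.
End Chains.

(** * Local structure and idempotents under the primariness of approximable ideals *)

Section SoberNoetherian.
Variable R : comPzRingType.
Hypothesis noethR : noetherian R.
Implicit Types (a m p q : set R) (x y z r s t e f g c d : R).

(** For an ideal [a], equivalently: the primary ideals above [a] form an irreducible closed subset
    of [Prm R] and intersect in [a]. *)
Definition approximable a := forall L : seq R, (forall x, x \in L -> ~ a x) ->
  exists q, [/\ is_primary q, a `<=` q & forall x, x \in L -> ~ q x].

Hypothesis approximable_primary : forall a, is_ideal a -> approximable a -> is_primary a.

Lemma local_closure_ideal a m : is_ideal a -> is_prime m -> is_ideal (local_closure a m).
Proof.
move=> [a0 aD aM] [_ m1 mpr]; split.
- by exists 1; rewrite ?mulr0.
- move=> x y [s ms asx] [t mt aty]; exists (s * t); first by move=> /mpr[].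
  have -> : s * t * (x + y) = t * (s * x) + s * (t * y) by ring.
  by apply: aD; apply: aM.
- by move=> r x [s ms asx]; exists s => //; rewrite mulrCA; apply: aM.
Qed.

(** One [m]-primary ideal avoids each given element, and the intersection of finitely many of them
    is still [m]-primary. *)
Lemma local_closure_primary a m : is_ideal a -> maximal_ideal m -> a `<=` m ->
  is_primary (local_closure a m).
Proof.
move=> aid mm am; have mpr := maximal_prime mm.
apply: approximable_primary; first exact: local_closure_ideal.
move=> L HL; suff [q [qm aq qL]] :
    exists q, [/\ coprimary m q, a `<=` q & forall x, x \in L -> ~ q x].
  exists q; split=> //; first exact: coprimary_primary qm.
  move=> x [s ms asx]; apply: (coprimary_cancel mm qm ms).
  by rewrite mulrC; apply: aq.
elim: L HL => [|x L IH] HL; first by exists m; split=> //; apply: coprimary_maximal.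
have [|q [qm aq qL]] := IH; first by move=> y yL; apply: HL; rewrite inE yL orbT.
have [|q' [qm' aq' qx]] := exists_coprimary noethR aid mm (x := x).
  exact/HL/mem_head.
exists (q `&` q'); split; first exact: coprimaryI.
  by move=> z az; split; [exact: aq|exact: aq'].
by move=> y; rewrite inE => /predU1P[->|/qL nq] [].
Qed.

(** So [p] is the kernel of localization at [m]. With [y] in [m] outside [p], the contraction of
    [m x] contains [x * y] but no power of [y], hence it contains [x]: [s * x = t * x] with [t] in
    [m], and [s - t] kills [x]. *)
Lemma prime_local_zero p m : is_prime p -> maximal_ideal m -> p `<` m ->
  forall x, p x <-> exists2 s, ~ m s & s * x = 0.
Proof.
move=> [pid p1 ppr] mm [pm mp] x; have [mid m1 mmax] := mm.
split=> [px|[s ms sx0]]; last first.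
  have /ppr[/pm//|//] : p (s * x) by rewrite sx0; case: pid.
have [y my py] : exists2 y, m y & ~ p y.
  by apply: contrapT => nex; apply: mp => y my; apply: contrapT => py; apply: nex; exists y.
pose a := [set z | exists2 t, m t & z = t * x].
have aid : is_ideal a.
  case: mid => m0 mD mM; split.
  - by exists 0; rewrite ?mul0r.
  - by move=> _ _ [t mt ->] [k mk ->]; exists (t + k); [exact: mD|rewrite mulrDl].
  - by move=> r _ [t mt ->]; exists (r * t); [exact: mM|rewrite mulrA].
have ap : a `<=` p by move=> _ [t mt ->]; case: pid => _ _; apply.
have am : a `<=` m := subset_trans ap pm.
have [lid _ lpr] := local_closure_primary aid mm am.
have lxy : local_closure a m (x * y).
  by exists 1 => //; rewrite mul1r mulrC; exists y.
case: (lpr _ _ lxy) => [[s ms [t mt sxt]]|[n [s ms /ap psy]]].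
  exists (s - t); first by move=> /(idealBK mid mt).
  by rewrite mulrBl sxt subrr.
have ps : ~ p s by move=> /pm.
by case: (ppr _ _ psy) => // /(primeX (And3 pid p1 ppr)).
Qed.

(** Multiply the annihilators of finitely many generators of [p]. *)
Lemma exists_annihilator p m : is_ideal p -> is_prime m ->
  (forall x, p x -> exists2 s, ~ m s & s * x = 0) ->
  exists2 s, ~ m s & forall x, p x -> s * x = 0.
Proof.
move=> pid [_ m1 mpr] H; have [L LE] := noethR pid.
have Lp : [set` L] `<=` p by rewrite LE; apply: sub_gen_smallest.
have [s ms sL] : exists2 s, ~ m s & forall x, x \in L -> s * x = 0.
  elim: L {LE} Lp => [|x L IH] Lp; first by exists 1.
  have [|s ms sL] := IH; first by move=> y yL; apply: Lp; rewrite /= inE [y \in L]yL orbT.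
  have [t mt tx] := H _ (Lp x (mem_head _ _)).
  exists (s * t); first by move=> /mpr[].
  move=> y; rewrite inE => /predU1P[->|/sL sy]; first by rewrite -mulrA tx mulr0.
  by rewrite mulrAC sy mul0r.
exists s => // x; rewrite LE => /(_ [set x | s * x = 0]); apply; split=> //.
split; first by rewrite /mkset mulr0.
  by move=> y z; rewrite /mkset mulrDr => -> ->; rewrite addr0.
by move=> r y; rewrite /mkset mulrCA => ->; rewrite mulr0.
Qed.

Definition primitive_idem e :=
  [/\ e * e = e, e <> 0 & forall c, c * c = c -> e * c = c -> c = 0 \/ c = e].

Definition orth_decomp e (L : seq R) := [/\ uniq L,
  forall f, f \in L -> primitive_idem f,
  forall f g, f \in L -> g \in L -> f <> g -> f * g = 0 &
  \sum_(f <- L) f = e].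

Lemma orth_decomp_sub e (L : seq R) : orth_decomp e L -> forall f, f \in L -> e * f = f.
Proof.
move=> [uL pL oL <-] f fL; rewrite mulr_suml (bigD1_seq f)//=.
rewrite big_seq_cond big1 ?addr0; first by case: (pL _ fL).
by move=> g /andP[gL /eqP gf]; apply: oL.
Qed.

(** Noetherian induction on annihilators: an idempotent strictly below [f] has a strictly larger
    annihilator, so a maximal counterexample [f] splits as [c + (f - c)] with both parts
    decomposable. *)
Lemma exists_orth_decomp e : e * e = e -> exists L, orth_decomp e L.
Proof.
move=> ee; apply: contrapT => bad.
have ann_ideal f : is_ideal [set x | f * x = 0].
  split; first by rewrite /mkset mulr0.
    by move=> y z; rewrite /mkset mulrDr => -> ->; rewrite addr0.
  by move=> r y; rewrite /mkset mulrCA => ->; rewrite mulr0.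
pose C := [set [set x | f * x = 0] | f in
  [set f | f * f = f /\ ~ exists L, orth_decomp f L]].
have [||_ [f [ff fbad] <-] fmax] := noetherian_max noethR (C := C).
- by move=> _ [f _ <-].
- by exists [set x | e * x = 0], e.
have good c : c * c = c -> f * c = c -> c <> f -> exists L, orth_decomp c L.
  move=> cc fc cf; apply: contrapT => cbad.
  have /(congr1 (fun A : set R => A (f - c))) : [set x | c * x = 0] = [set x | f * x = 0].
    apply: fmax; first by exists c.
    by move=> x /= fx; rewrite -fc mulrAC fx mul0r.
  rewrite /mkset !mulrBr ff fc cc (mulrC c) fc subrr => /esym e0.
  by apply: cf; apply/esym/eqP; rewrite -subr_eq0; apply/eqP; rewrite e0.
apply: fbad.
have [->|f0] := pselect (f = 0); first by exists [::]; split; rewrite ?big_nil.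
have [pf|] := pselect (forall c, c * c = c -> f * c = c -> c = 0 \/ c = f).
  exists [:: f]; split=> //; last by rewrite big_seq1.
    by move=> g; rewrite inE => /eqP ->.
  by move=> g h; rewrite !inE => /eqP -> /eqP ->.
move=> /existsNP[c /not_implyP[cc /not_implyP[fc /not_orP[c0 cf]]]].
pose d := f - c.
have dd : d * d = d.
  by rewrite /d mulrBl !mulrBr ff fc cc (mulrC c) fc subrr subr0.
have fd : f * d = d by rewrite /d mulrBr ff fc.
have cd : c * d = 0 by rewrite /d mulrBr cc mulrC fc subrr.
have [L1 D1] := good _ cc fc cf.
have [|L2 D2] := good _ dd fd.
  by move=> /(congr1 (fun x => f - x)); rewrite subrr /d subKr.
have S1 := orth_decomp_sub D1; have S2 := orth_decomp_sub D2.
have o12 g h : g \in L1 -> h \in L2 -> g * h = 0.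
  by move=> /S1 <- /S2 <-; rewrite mulrACA cd mul0r.
have [u1 p1 o1 s1] := D1; have [u2 p2 o2 s2] := D2.
exists (L1 ++ L2); split.
- rewrite cat_uniq u1 u2 andbT; apply/hasPn => g gL2; apply/negP => gL1.
  by have [gg] := p1 _ gL1; rewrite -gg o12.
- by move=> g; rewrite mem_cat => /orP[/p1|/p2].
- move=> g h; rewrite !mem_cat => /orP[g1|g2] /orP[h1|h2] gh.
  + exact: o1.
  + exact: o12.
  + by rewrite mulrC; apply: o12.
  + exact: o2.
- by rewrite big_cat /= s1 s2 /d addrC subrK.
Qed.

Lemma idem_not_maximal e : e * e = e -> e <> 0 -> exists2 m, maximal_ideal m & ~ m e.
Proof.
move=> ee e0.
pose I := [set x | e * x = 0].
have Iid : is_ideal I.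
  split; first by rewrite /I /mkset mulr0.
    by move=> y z; rewrite /I /mkset mulrDr => -> ->; rewrite addr0.
  by move=> r y; rewrite /I /mkset mulrCA => ->; rewrite mulr0.
have [|m mm Im] := exists_maximal noethR Iid; first by rewrite /I /mkset mulr1.
exists m => // me; have [mid m1 _] := mm; apply: m1.
apply: (idealBK mid me); apply: Im.
by rewrite /I /mkset mulrBr mulr1 ee subrr.
Qed.

Lemma idem_notin_sup e p q : e * e = e -> is_prime p -> is_ideal q -> ~ q 1 ->
  p `<=` q -> ~ p e -> ~ q e.
Proof.
move=> ee [[p0 _ _] _ ppr] qid q1 pq pe qe; apply: q1; apply: (idealBK qid qe); apply: pq.
have : p (e * (1 - e)) by rewrite mulrBr mulr1 ee subrr.
by move=> /ppr[].
Qed.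

(** If two primes avoiding [e] are nested, the smaller one [p] is comaximal with its annihilator.
    This yields an idempotent, and primitivity of [e] forces [e] to kill [p], so the corner is a
    domain. *)
Lemma corner_krull_dim e (pe : primitive_idem e) (ee : e * e = e) :
  has_krull_dim (corner ee) 0 \/
  has_krull_dim (corner ee) 1 /\ is_integral_domain (corner ee).
Proof.
have [_ e0 eprim] := pe.
have [[p [q [ppr qpr qe pq]]]|nchain] :=
  pselect (exists p q, [/\ is_prime p, is_prime q, ~ q e & p `<` q]); last first.
  left; apply/krull_dim0; split.
    have [m mm me] := idem_not_maximal ee e0.
    exact: inhabits (MkSpec (push_prime ee (maximal_prime mm) me)).
  move=> P Q PQ; apply: nchain; exists (pull (prime_set P)), (pull (prime_set Q)).
  have [? ?] := pull_prime (prime_setP P); have [? ?] := pull_prime (prime_setP Q).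
  by split=> //; apply: pull_proper.
right.
have above q' : is_prime q' -> ~ q' e ->
    exists m, [/\ maximal_ideal m, q' `<=` m & ~ m e].
  move=> q'pr q'e; have [q'id q'1 _] := q'pr.
  have [m mm q'm] := exists_maximal noethR q'id q'1.
  by exists m; split=> //; have [mid m1 _] := mm; apply: idem_notin_sup q'm q'e.
have [m [mm qm me]] := above _ qpr qe.
have mpr := maximal_prime mm.
have pm : p `<` m.
  case: pq => pq qp; split; first exact: subset_trans qm.
  by move=> mp; apply: qp; apply: subset_trans mp.
have pe' : ~ p e by move=> /pm.1.
have [pid p1 ppr'] := ppr.
have [s ms sp] : exists2 s, ~ m s & forall x, p x -> s * x = 0.
  by apply: exists_annihilator => // x /(prime_local_zero ppr mm pm).
pose c := [set t | forall x, p x -> t * x = 0].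
have cid : is_ideal c.
  split; first by move=> x _; rewrite mul0r.
    by move=> t k ct ck x px; rewrite mulrDl ct// ck// addr0.
  by move=> r t ct x px; rewrite -mulrA ct// mulr0.
(* A maximal [n] above both [c] and [p] would be strictly above [p], which is not maximal; then some
   element outside [n] kills [p], although [c] lies in [n]. *)
have [t [w [ct pw e1]]] : exists t w, [/\ c t, p w & 1 = t + w].
  apply: contrapT => nex.
  pose J := [set z | exists t w, [/\ c t, p w & z = t + w]].
  have [c0 cD cM] := cid; have [p0 pD pM] := pid.
  have Jid : is_ideal J.
    split; first by exists 0, 0; rewrite addr0.
      move=> _ _ [t [w [ct pw ->]]] [t' [w' [ct' pw' ->]]]; exists (t + t'), (w + w').
      by split; [exact: cD|exact: pD|rewrite addrACA].
    move=> r _ [t [w [ct pw ->]]]; exists (r * t), (r * w).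
    by split; [exact: cM|exact: pM|rewrite mulrDr].
  have [//|n nm Jn] := exists_maximal noethR Jid.
  have npr := maximal_prime nm; have [nid n1 _] := nm.
  have cn : c `<=` n by move=> t ct; apply: Jn; exists t, 0; rewrite addr0.
  have pn : p `<` n.
    split; first by move=> w pw; apply: Jn; exists 0, w; rewrite add0r.
    move=> np; have npe : n = p.
      by apply/seteqP; split=> // w pw; apply: Jn; exists 0, w; rewrite add0r.
    have [mid m1 _] := mm.
    apply: pm.2; rewrite -npe; suff -> : m = n by [].
    by apply: (maximal_eq nm mid m1); rewrite npe; exact: pm.1.
  have [s' ns' s'p] : exists2 s, ~ n s & forall x, p x -> s * x = 0.
    by apply: exists_annihilator => // x /(prime_local_zero ppr nm pn).
  exact/ns'/cn.
have tt : t * t = t.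
  by rewrite -[RHS]mulr1 e1 mulrDr [t * w]ct// addr0.
have ep x : p x -> e * x = 0.
  have [||et0|ete] := eprim (e * t).
  - by rewrite mulrACA ee tt.
  - by rewrite mulrA ee.
  - case: pe'; rewrite -[e]mulr1 e1 mulrDr et0 add0r.
    by case: pid => _ _; apply.
  - by move=> px; rewrite -ete -mulrA [t * x]ct// mulr0.
split; last split.
- apply/krull_dim1; split.
    exists (MkSpec (push_prime ee ppr pe')), (MkSpec (push_prime ee mpr me)).
    exact: push_proper.
  move=> P Q T PQ QT.
  have [P1 P2] := pull_prime (prime_setP P).
  have [Q1 Q2] := pull_prime (prime_setP Q).
  have [T1 T2] := pull_prime (prime_setP T).
  have [n [nm Tn ne]] := above _ T1 T2.
  have /pull_proper PQ' := PQ; have /pull_proper QT' := QT.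
  have Qn : pull (prime_set Q) `<` n.
    split; first exact: subset_trans QT'.1 Tn.
    by move=> nQ; apply: QT'.2; exact: subset_trans Tn nQ.
  have Pn : pull (prime_set P) `<` n.
    by apply: set_proper_trans PQ' Qn.
  (* Both primes lie strictly below [n], so both equal the kernel of localization at [n]. *)
  apply: PQ'.2 => x /(prime_local_zero Q1 nm Qn) h.
  exact/(prime_local_zero P1 nm Pn).
- by move=> /(congr1 val); rewrite val_corner1.
- move=> x y /(congr1 val); rewrite val_cornerM val_corner0 => xy.
  have /ppr'[px|py] : p (val x * val y) by rewrite xy; case: pid.
    by left; apply: val_inj; rewrite -cornerP ep.
  by right; apply: val_inj; rewrite -cornerP ep.
Qed.

Lemma sober_product : exists (I : Type) (A : I -> comPzRingType),
  iso_direct_product R A /\ forall i : I, has_krull_dim (A i) 0 \/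
    (has_krull_dim (A i) 1 /\ is_integral_domain (A i)).
Proof.
have [L [uL pL oL sL]] := exists_orth_decomp (mulr1 1).
have idL (f : {f | f \in L}) : val f * val f = val f by case: (pL _ (valP f)).
exists {f | f \in L}, (fun i => corner (idL i)); split; last first.
  by move=> f; apply: corner_krull_dim; apply/pL/valP.
exists (fun i => proj (idL i)).
pose ext (h : forall i, corner (idL i)) f : R :=
  if pselect (f \in L) is left fL
  then val (h (exist (fun g => is_true (g \in L)) f fL)) else 0.
exists (fun h => \sum_(f <- L) ext h f).
- move=> x; rewrite -[RHS]mul1r -sL mulr_suml; apply: eq_big_seq => f fL.
  by rewrite /ext; case: pselect => // fL'.
- move=> h; apply: functional_extensionality_dep => -[f fL]; apply: val_inj.
  rewrite val_proj /= mulr_sumr (bigD1_seq f)//= big_seq_cond big1 ?addr0.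
    rewrite /ext; case: pselect => // fL'.
    by rewrite (Prop_irrelevance fL' fL) cornerP.
  move=> g /andP[gL gf]; have fg : f <> g by move=> e; rewrite e eqxx in gf.
  rewrite /ext; case: pselect => // gL'.
  by rewrite -cornerP /= mulrA (oL _ _ fL gL fg) mul0r.
Qed.

End SoberNoetherian.

(** * The space of primary ideals *)

Section ConnectedIdeals.
Variable R : comPzRingType.
Implicit Types (a p m : set R) (e u v x : R).

Definition connected_ideal a := forall e, a (e * (1 - e)) -> a e \/ a (1 - e).

(** If [e] is not in [a], a power of [1 - e] is, so [e] is invertible modulo [a] and [e * (1 - e)]
    in [a] gives [1 - e] in [a]. *)
Lemma primary_connected a : is_primary a -> connected_ideal a.
Proof.
move=> [aid a1 apr] e ae; case: (apr _ _ ae) => [|[n an]]; [by left|right].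
have [r ar] := ideal_unit_pow aid an; have [_ aD aM] := aid.
have -> : 1 - e = (1 - e) * (1 - r * e) + r * (e * (1 - e)) by ring.
by apply: aD; apply: aM.
Qed.

Hypothesis noethR : noetherian R.

Lemma connected_primary a : is_ideal a -> ~ a 1 -> connected_ideal a ->
  (forall p, is_prime p -> a `<=` p -> maximal_ideal p) -> is_primary a.
Proof.
move=> aid a1 acon amax; split=> // u v auv; apply: contrapT => /not_orP[nu nv].
have [a0 aD aM] := aid.
pose S := [set x | exists n t, x = v ^+ n * (1 - v * t)].
(* Otherwise some prime above [a] misses [S], hence misses [v] and all [1 - v * t]; it would not be
   maximal. *)
have [n [t avt]] : exists n t, a (v ^+ n * (1 - v * t)).
  apply: contrapT => nex.
  have [||x [n [t ->]] ax|p [ppr ap] pS] := exists_prime_disjoint noethR (S := S) aid.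
  - by exists 0%N, 0; rewrite mulr0 subr0 mul1r.
  - move=> _ _ [n [t ->]] [k [s ->]]; exists (n + k)%N, (t + s - v * t * s).
    by rewrite exprD; ring.
  - by apply: nex; exists n, t.
  - have npv : ~ p v by apply: pS; exists 1%N, 0; rewrite mulr0 subr0 mulr1.
    have [_ _ /(_ _ npv)[r pr]] := amax _ ppr ap.
    apply: pS pr; exists 0%N, r; by rewrite mul1r mulrC.
have Iid : is_ideal [set y | a (v ^+ n.+1 * y)].
  split; first by rewrite /mkset mulr0.
    by move=> y z; rewrite /mkset mulrDr; apply: aD.
  by move=> r y ay; rewrite /mkset mulrCA; apply: aM.
(* As [v ^+ n * (1 - v * t)] lies in [a], modulo [a] one has
   [v ^+ n.+1 = v ^+ n.+1 * w], and therefore [w] is idempotent. *)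
pose w := (v * t) ^+ n.+1.
have aw : a (v ^+ n.+1 * (1 - w)).
  rewrite -(expr1n _ n.+1); apply: (ideal_eqmodX n.+1 Iid).
  by rewrite /mkset exprS -mulrA; apply: aM.
have : a (w * (1 - w)).
  by rewrite {1}/w exprMn mulrC mulrA mulrC (mulrC _ (v ^+ _)); apply: aM.
(* Modulo [a], either [w] is 0 and [v] is nilpotent, or [w] is 1 and [v] is invertible, which puts
   [u] in [a]. *)
case/acon => [aw'|aw'].
  apply: nv; exists n.+1.
  have -> : v ^+ n.+1 = v ^+ n.+1 * (1 - w) + v ^+ n.+1 * w by ring.
  by apply: aD => //; apply: aM.
apply: nu; have -> : u = u * (1 - w) + v ^+ n * t ^+ n.+1 * (u * v).
  by rewrite /w exprMn exprS; ring.
by apply: aD; apply: aM.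
Qed.

End ConnectedIdeals.

Lemma image_prime (R A : comPzRingType) (f : {rmorphism R -> A}) (p : set R) :
  (forall y, exists x, f x = y) -> is_prime p -> (forall x, f x = 0 -> p x) ->
  (forall x, [set f x | x in p] (f x) <-> p x) /\ is_prime [set f x | x in p].
Proof.
move=> surj [pid p1 ppr] kerp; have [p0 pD pM] := pid.
have mem x : [set f x | x in p] (f x) <-> p x.
  split=> [[y py fyx]|px]; last by exists x.
  apply: (idealBK pid py); apply: kerp.
  by rewrite rmorphB fyx subrr.
split=> //; split.
- split.
  + by exists 0; rewrite ?rmorph0.
  + by move=> _ _ [x px <-] [y py <-]; exists (x + y); [exact: pD|rewrite rmorphD].
  + move=> b _ [x px <-]; have [y <-] := surj b.
    by exists (y * x); [exact: pM|rewrite rmorphM].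
- by rewrite -(rmorph1 f) => /mem.
- move=> b c; have [x <-] := surj b; have [y <-] := surj c.
  by rewrite -rmorphM => /mem /ppr[px|py]; [left|right]; apply/mem.
Qed.

(** * Primary ideals of a product of the prescribed rings *)

Section Product.
Variables (R : comPzRingType) (noethR : noetherian R).
Variables (I : Type) (A : I -> comPzRingType) (phi : forall i, {rmorphism R -> A i}).
Hypothesis phi_bij : bijective (fun (x : R) (i : I) => phi i x).
Hypothesis dimA : forall i, has_krull_dim (A i) 0 \/
  (has_krull_dim (A i) 1 /\ is_integral_domain (A i)).
Implicit Types (a p m : set R) (x y z : R) (J : set I).

Lemma factor_nonzero i : (1 : A i) <> 0.
Proof.
have [P] : inhabited (Spec (A i)).
  by case: (dimA i) => [/krull_dim0[]//|[/krull_dim1[[P _] _] _]].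
by have [[P0 _ _] P1 _] := prime_setP P => e; apply: P1; rewrite e.
Qed.

Lemma phi_inj x y : (forall i, phi i x = phi i y) -> x = y.
Proof.
move=> h; have [psi phiK _] := phi_bij; rewrite -(phiK x) -(phiK y).
by congr psi; apply: functional_extensionality_dep.
Qed.

Lemma phi_surj (z : forall i, A i) : exists x, forall i, phi i x = z i.
Proof.
have [psi _ psiK] := phi_bij; exists (psi z) => i.
exact: (congr1 (fun h : forall i, A i => h i) (psiK z)).
Qed.

Lemma phi_surj1 i (b : A i) : exists x, phi i x = b.
Proof.
have [z zi] : exists z : forall j, A j, z i = b.
  exists (fun j => if pselect (i = j) is left e then ecast j (A j) e b else 0).
  by case: pselect => // e; rewrite (Prop_irrelevance e erefl).
by have [x hx] := phi_surj z; exists x; rewrite hx.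
Qed.

Lemma exists_delta J : exists d : R,
  (forall i, J i -> phi i d = 1) /\ (forall i, ~ J i -> phi i d = 0).
Proof.
have [d hd] := phi_surj (fun i => if pselect (J i) then 1 else 0).
by exists d; split=> i Ji; rewrite hd; case: pselect.
Qed.

(** If [a] contained no kernel, connectedness would put the idempotent of each single factor in [a].
    The ascending chain condition on principal ideals generated by 0-1 elements of [a] then puts 1
    in [a], without first proving [I] finite. *)
Lemma connected_factor a : is_ideal a -> ~ a 1 -> connected_ideal a ->
  exists i, forall x, phi i x = 0 -> a x.
Proof.
move=> aid a1 acon; have [a0 aD aM] := aid; apply: contrapT => nex.
have delta_in i d : (phi i d = 1) -> (forall j, j <> i -> phi j d = 0) -> a d.
  move=> di dj; have : a (d * (1 - d)).
    suff -> : d * (1 - d) = 0 by [].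
    apply: phi_inj => j; rewrite rmorphM rmorphB !rmorph1 rmorph0.
    have [->|ji] := pselect (j = i); first by rewrite di subrr mulr0.
    by rewrite dj// mul0r.
  case/acon => // ad; case: nex; exists i => x xi.
  have -> : x = x * (1 - d).
    apply: phi_inj => j; rewrite rmorphM rmorphB !rmorph1.
    have [->|ji] := pselect (j = i); first by rewrite xi mul0r.
    by rewrite dj// subr0 mulr1.
  exact: aM.
pose C := [set [set r * d | r in [set: R]] | d in
  [set d | a d /\ forall i, phi i d = 1 \/ phi i d = 0]].
have [||_ [d [ad d01] <-] dmax] := noetherian_max noethR (C := C).
- move=> _ [d _ <-]; split; first by exists 0; rewrite ?mul0r.
    by move=> _ _ [r _ <-] [s _ <-]; exists (r + s); rewrite ?mulrDl.
  by move=> s _ [r _ <-]; exists (s * r); rewrite ?mulrA.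
- exists [set r * 0 | r in [set: R]], 0 => //; split=> // i.
  by right; rewrite rmorph0.
have [d1|/existsNP[i di1]] := pselect (forall i, phi i d = 1).
  by apply: a1; suff <- : d = 1 by []; apply: phi_inj => i; rewrite d1 rmorph1.
have di : phi i d = 0 by case: (d01 i).
(* Changing the coordinate of [d] at [i] from 0 to 1 enlarges the ideal, against maximality. *)
have [c [ci cj]] := exists_delta [set i].
have ac : a c by apply: (delta_in i) => [|j ji]; [exact: ci|apply: cj].
have : [set r * (d + c) | r in [set: R]] = [set r * d | r in [set: R]].
  apply: dmax.
    exists (d + c) => //; split; first exact: aD.
    move=> j; rewrite rmorphD; have [->|ji] := pselect (j = i).
      by left; rewrite di ci// add0r.
    by rewrite (cj j ji) addr0.
  move=> _ [r _ <-]; exists (r * d) => //.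
  apply: phi_inj => j; rewrite !rmorphM rmorphD.
  have [->|ji] := pselect (j = i); first by rewrite di mulr0 mul0r.
  rewrite (cj j ji) addr0 -mulrA.
  by case: (d01 j) => ->; rewrite ?mulr1 ?mulr0.
move=> /(congr1 (fun A => A (d + c))) e.
have : [set r * (d + c) | r in [set: R]] (d + c) by exists 1; rewrite ?mul1r.
rewrite {}e => -[r _ /(congr1 (phi i))].
rewrite rmorphM rmorphD di ci// mulr0 add0r => /esym.
exact: factor_nonzero.
Qed.

(** The ideal [a] comes from one factor. If it is the zero ideal of a domain, it is prime; otherwise
    all primes above it are maximal, by the bound on dimension. *)
Lemma product_connected_primary a :
  is_ideal a -> ~ a 1 -> connected_ideal a -> is_primary a.
Proof.
move=> aid a1 acon; have [i kera] := connected_factor aid a1 acon.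
have [z0|nz0] := pselect ((forall x, a x -> phi i x = 0) /\ is_integral_domain (A i)).
  have [az [_ dom]] := z0.
  apply: prime_primary; split=> // x y axy.
  have /dom[x0|y0] : phi i x * phi i y = 0 by rewrite -rmorphM az.
    by left; apply: kera.
  by right; apply: kera.
apply: (connected_primary noethR) => // p ppr ap.
have [pid p1 _] := ppr; have [m mm pm] := exists_maximal noethR pid p1.
have [mp|nmp] := pselect (m `<=` p).
  by have -> : p = m by apply/seteqP.
exfalso.
have [pmem ppr'] := image_prime (@phi_surj1 i) ppr (fun x h => ap _ (kera _ h)).
have [mmem mpr'] := image_prime (@phi_surj1 i) (maximal_prime mm)
  (fun x h => pm _ (ap _ (kera _ h))).
have PM : MkSpec ppr' `<` MkSpec mpr'.
  split=> [_ [x px <-]|mp']; first by apply/mmem/pm.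
  by apply: nmp => x mx; apply/pmem/mp'/mmem.
case: (dimA i) => [/krull_dim0[_ /(_ _ _ PM)//]|[/krull_dim1[_ h] Adom]].
have /existsNP[x /not_implyP[ax phx]] : ~ forall x, a x -> phi i x = 0.
  by move=> az; apply: nz0.
have zpr : is_prime [set 0 : A i].
  case: Adom => A1 dom; split=> //; split=> //.
    by move=> u v -> ->; rewrite /= addr0.
  by move=> r u ->; rewrite /= mulr0.
(* In the domain [A i], the zero ideal and the images of [p] and [m] would form a chain of length
   two. *)
apply: (h (MkSpec zpr) _ _ _ PM); split=> [_ ->|P0].
  by have [[]] := ppr'.
by apply: phx; apply: P0; apply/pmem/ap.
Qed.

End Product.

(** The generic point is the intersection of all primes in [F], which is prime because [F] is
    irreducible. *)
Lemma Spec_sober (A : comPzRingType) : sober (Spec A).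
Proof.
move=> F [Fcl [Q0 FQ0] Firr].
have [Z FE] : exists Z, F = zeros Z.
  have [Z ZE] : open (~` F) by rewrite openC.
  by exists Z; rewrite -[LHS]setCK ZE setCK.
have zeros_closed (x : A) : closed (zeros [set x]) by rewrite -openC; exists [set x].
pose p := [set x | forall Q : Spec A, F Q -> prime_set Q x].
have ppr : is_prime p.
  split.
  - split.
    + by move=> Q _; case: (prime_setP Q) => -[].
    + by move=> x y px py Q FQ; case: (prime_setP Q) => -[_ QD _] _ _; apply: QD; auto.
    + by move=> r x px Q FQ; case: (prime_setP Q) => -[_ _ QM] _ _; apply: QM; auto.
  - by move=> /(_ _ FQ0); case: (prime_setP Q0).
  - move=> x y pxy; have [|Fx|Fy] :=
      Firr (zeros [set x]) (zeros [set y]) (zeros_closed x) (zeros_closed y).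
    + move=> Q FQ; case: (prime_setP Q) => _ _ Qpr.
      by case: (Qpr _ _ (pxy _ FQ)); [left|right] => _ ->.
    + by left=> Q /Fx; apply.
    + by right=> Q /Fy; apply.
exists (MkSpec ppr); apply/seteqP; split.
- move=> Q FQ B; rewrite nbhsE => -[V [[Z' ->] VQ] VB].
  exists (MkSpec ppr); split=> //; apply: VB => pZ; apply: VQ => x /pZ.
  exact.
- rewrite [X in _ `<=` X](proj1 (closure_id F) Fcl).
  apply: closure_subset => _ ->.
  by rewrite FE => x Zx Q; rewrite FE => /(_ _ Zx).
Qed.

Lemma homeomorphic_sober (X Y : topologicalType) :
  homeomorphic X Y -> sober Y -> sober X.
Proof.
move=> [f [g [fc gc fK gK]]] Ysob F [Fcl [x0 Fx0] Firr].
have [|y yE] := Ysob (g @^-1` F).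
  split.
  - exact: (continuous_closedP g).1.
  - by exists (f x0); rewrite /preimage /= fK.
  - move=> F1 F2 F1cl F2cl sub.
    have [|||h|h] := Firr (f @^-1` F1) (f @^-1` F2).
    + exact: (continuous_closedP f).1.
    + exact: (continuous_closedP f).1.
    + by move=> x Fx; apply: sub; rewrite /preimage /= fK.
    + by left=> y /h; rewrite /preimage /= gK.
    + by right=> y /h; rewrite /preimage /= gK.
exists (g y); apply/seteqP; split=> x.
- move=> Fx B Bx; have : (g @^-1` F) (f x) by rewrite /preimage /= fK.
  rewrite yE => /(_ (g @^-1` B)) [|z [-> Bz]]; last by exists (g y).
  by apply: gc; rewrite fK.
- move=> cx; have Fgy : F (g y).
    suff : (g @^-1` F) y by [].
    by rewrite yE; apply: subset_closure.
  rewrite (proj1 (closure_id F) Fcl); apply: closure_subset cx.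
  by move=> _ ->.
Qed.

(** * The subspace of primary ideals and its subbasis *)

Section PrimarySpace.
Variable R : comPzRingType.
Local Notation X := (set_type (Prm R)).
Implicit Types (q : X) (x : R).

Definition prm_set q : set R := ideal_set (set_val q).

Lemma prm_setP q : is_primary (prm_set q).
Proof. exact: (set_mem (valP q)). Qed.

Lemma exists_prm (a : set R) : is_primary a -> exists q, prm_set q = a.
Proof.
move=> apr; have [aid _ _] := apr.
by exists (SigSub (mem_set (apr : Prm R (MkIdl aid)))).
Qed.

Lemma prm_inj q q' : (forall x, prm_set q x <-> prm_set q' x) -> q = q'.
Proof.
move=> h; apply: val_inj.
have : prm_set q = prm_set q' by apply/seteqP; split=> x /h.
rewrite /prm_set !set_valE /=; case: (val q) => a aid; case: (val q') => b bid /= e.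
by move: aid bid; rewrite e => aid bid; congr MkIdl; apply: Prop_irrelevance.
Qed.

Definition avoids x : set X := [set q | ~ prm_set q x].

Lemma up_closed (a : Idl R) : closed (up a).
Proof.
rewrite -openC; exists [set ~` up a]; last by rewrite bigcup_set1.
by move=> _ ->; apply: finI_from1.
Qed.

Lemma prm_up_closed (a : set R) : is_ideal a -> closed [set q | a `<=` prm_set q].
Proof.
move=> aid; rewrite -openC; exists (~` up (MkIdl aid)); last by [].
by rewrite openC; apply: up_closed.
Qed.

Lemma avoids_open x : open (avoids x).
Proof.
pose a := [set r * x | r in [set: R]].
have aid : is_ideal a.
  split; first by exists 0; rewrite ?mul0r.
    by move=> _ _ [r _ <-] [s _ <-]; exists (r + s); rewrite ?mulrDl.
  by move=> s _ [r _ <-]; exists (s * r); rewrite ?mulrA.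
suff -> : avoids x = ~` [set q | a `<=` prm_set q].
  by rewrite openC; apply: prm_up_closed.
apply/seteqP; split=> q.
  by move=> nqx /(_ x); apply: contra_not nqx; apply; exists 1; rewrite ?mul1r.
move=> na qx; apply: na => _ [r _ <-]; have [[_ _ qM] _ _] := prm_setP q.
exact: qM.
Qed.

(** A basic open set is a finite intersection of complements of sets [up a]; one element of each [a]
    outside [q] is enough. *)
Lemma avoids_nbhs (U : set X) q : open U -> U q ->
  exists2 L : seq R, (forall x, x \in L -> avoids x q) &
    forall q', (forall x, x \in L -> avoids x q') -> U q'.
Proof.
move=> [V [D Dsub <-] <-] [B DB Bq].
have [L _ LE] := Dsub _ DB.
suff [M Mq MB] : exists2 M : seq R, (forall x, x \in M -> avoids x q) &
    forall q', (forall x, x \in M -> avoids x q') -> B (set_val q').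
  by exists M => // q' /MB Bq'; exists B.
rewrite -{}LE in Bq *.
suff [M Mq MB] : exists2 M : seq R, (forall x, x \in M -> avoids x q) &
    forall q', (forall x, x \in M -> avoids x q') ->
      forall i, i \in (enum_fset L : seq (Idl R)) -> ~ up i (set_val q').
  by exists M => // q' /MB.
have {}Bq : forall i, i \in (enum_fset L : seq (Idl R)) -> ~ up i (set_val q) by [].
elim: (enum_fset L : seq (Idl R)) Bq => [|a K IH] H; first by exists [::].
have [|M Mq MB] := IH; first by move=> i iK; apply: H; rewrite inE iK orbT.
have /existsNP[x /not_implyP[ax qx]] := H a (mem_head _ _).
exists (x :: M); first by move=> y; rewrite inE => /predU1P[->//|/Mq].
move=> q' q'M i; rewrite inE => /predU1P[->|iK].
  by move=> /(_ _ ax); apply: (q'M x); apply: mem_head.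
by apply: MB => // y yM; apply: q'M; rewrite inE yM orbT.
Qed.

(** Approximability makes the closed set of primary ideals above [a] irreducible. Its generic point
    is [a]: an element of that point outside [a] would be avoided by another member of the set. *)
Lemma sober_approximable : sober X -> forall a : set R, is_ideal a ->
  approximable a -> is_primary a.
Proof.
move=> sob a aid aapp; pose F := [set q | a `<=` prm_set q].
have [|q FE] := sob F.
  split.
  - exact: prm_up_closed.
  - have [|b [bpr ab _]] := aapp [::]; first by [].
    by have [q qb] := exists_prm bpr; exists q; rewrite /F /= qb.
  - move=> F1 F2 F1cl F2cl sub; apply: contrapT => /not_orP[].
    move=> /existsNP[q1 /not_implyP[Fq1 nq1]] /existsNP[q2 /not_implyP[Fq2 nq2]].
    have o1 : open (~` F1) by rewrite openC.
    have o2 : open (~` F2) by rewrite openC.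
    have [L1 L1q L1F] := avoids_nbhs o1 nq1.
    have [L2 L2q L2F] := avoids_nbhs o2 nq2.
    have [|b [bpr ab bL]] := aapp (L1 ++ L2).
      by move=> x; rewrite mem_cat => /orP[/L1q|/L2q] nx ax; apply: nx;
        [apply: Fq1|apply: Fq2].
    have [q qb] := exists_prm bpr.
    have [|Fq|Fq] := sub q; first by rewrite /F /= qb.
    + by apply: L1F Fq => x xL; rewrite /avoids /= qb; apply: bL; rewrite mem_cat xL.
    + by apply: L2F Fq => x xL; rewrite /avoids /= qb; apply: bL; rewrite mem_cat xL orbT.
suff -> : a = prm_set q by apply: prm_setP.
have Fq : F q by rewrite FE; apply: subset_closure.
apply/seteqP; split=> // x qx; apply: contrapT => nax.
have [|b [bpr ab bx]] := aapp [:: x]; first by move=> y; rewrite inE => /eqP ->.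
have [q' q'b] := exists_prm bpr.
have : F q' by rewrite /F /= q'b.
rewrite FE => /(_ (avoids x))[|z [-> ]]; last by apply.
apply: open_nbhs_nbhs; split; first exact: avoids_open.
by rewrite /avoids /= q'b; apply: bx; apply: mem_head.
Qed.

(** The limit along an ultrafilter consists of the elements lying in almost all of the primary
    ideals. It is again a proper connected ideal, hence primary by the hypothesis. *)
Lemma prm_spectral :
  (forall a : set R, is_ideal a -> ~ a 1 -> connected_ideal a -> is_primary a) ->
  spectral X.
Proof.
move=> conP; apply: (@subbasis_spectral X R avoids).
- exact: avoids_open.
- exact: avoids_nbhs.
- move=> q q' h; apply: prm_inj => x.
  by split=> qx; apply: contrapT => /h; apply.
move=> U UU; pose a := [set x | U [set q | prm_set q x]].
have aP x : a x <-> ~ U (avoids x).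
  split=> [ax nax|].
    by have [q []] := filter_ex (filterI ax nax).
  by have [|//] := in_ultra_setVsetC [set q | prm_set q x] UU.
have [q qa] : exists q, prm_set q = a.
  apply: exists_prm; apply: conP.
  - split.
    + apply: filterS filterT => q _; have [[q0 _ _] _ _] := prm_setP q; exact: q0.
    + move=> x y ax ay; apply: filterS (filterI ax ay) => q [].
      by have [[_ qD _] _ _] := prm_setP q; apply: qD.
    + move=> r x; apply: filterS => q.
      by have [[_ _ qM] _ _] := prm_setP q; apply: qM.
  - by move=> /filter_ex[q]; have [_ q1 _] := prm_setP q.
  - move=> e ae; apply: contrapT => /not_orP[/aP/contrapT ne /aP/contrapT n1e].
    have [q [[qe q1] q2]] := filter_ex (filterI (filterI ae ne) n1e).
    by case: (primary_connected (prm_setP q) qe).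
exists q => x; rewrite /avoids /= qa; split=> [/aP/contrapT//|Ux /aP//].
Qed.

End PrimarySpace.

Theorem theorem4p15 (R : comPzRingType) (noethR : noetherian R) :
  (sober (set_type (Prm R)) <-> spectral (set_type (Prm R))) /\
  (spectral (set_type (Prm R)) <->
    exists (I : Type) (A : I -> comPzRingType),
      iso_direct_product R A /\
      forall i : I, has_krull_dim (A i) 0 \/
        (has_krull_dim (A i) 1 /\ is_integral_domain (A i))).
Proof.
have spectral_sober : spectral (set_type (Prm R)) -> sober (set_type (Prm R)).
  by move=> [A /homeomorphic_sober]; apply; apply: Spec_sober.
have sober_prod := fun sob => sober_product noethR (sober_approximable sob).
have prod_spectral : (exists (I : Type) (A : I -> comPzRingType),
    iso_direct_product R A /\ forall i : I, has_krull_dim (A i) 0 \/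
      (has_krull_dim (A i) 1 /\ is_integral_domain (A i))) ->
    spectral (set_type (Prm R)).
  move=> [I [A [[phi phi_bij] dimA]]]; apply: prm_spectral.
  exact: product_connected_primary phi_bij dimA.
by split; split=> [?|?]; auto.
Qed.
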